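(* Let $\sigma>0$, $k>0$, and let $x\in\mathbb R_+^{\mathbb Z}$ be a good infinite-volume configuration for ABEP$(\sigma,k)$. Then for every $i\in\mathbb Z$ and $t\ge0$ the first exponential moment of the current $J_i(t)$ of the ABEP$(\sigma,k)$ on $\mathbb Z$ started from $x$ at time $0$ is $$\mathbb E_x\big[e^{-2\sigma J_i(t)}\big]=e^{-4kt}\sum_{n\in\mathbb Z}e^{-2\sigma(E_n(x)-E_i(x))}\,I_{|n-i|}(4kt),$$ where $I_n$ is the modified Bessel function (of the first kind).
   Context: $\mathbb R_+=[0,\infty)$, $\mathbb N=\{0,1,2,\dots\}$. ABEP$(\sigma,k)$ on $\mathbb Z$ is the Markov process with generator $\sum_{i\in\mathbb Z}\mathcal L_{i,i+1}$, $$\mathcal L_{i,i+1}f(x)=\tfrac1{4\sigma^2}(1-e^{-2\sigma x_i})(e^{2\sigma x_{i+1}}-1)\Big(\tfrac{\partial}{\partial x_i}-\tfrac{\partial}{\partial x_{i+1}}\Big)^2f(x)-\tfrac1{2\sigma}\Big\{(1-e^{-2\sigma x_i})(e^{2\sigma x_{i+1}}-1)+2k\big(2-e^{-2\sigma x_i}-e^{2\sigma x_{i+1}}\big)\Big\}\Big(\tfrac{\partial}{\partial x_i}-\tfrac{\partial}{\partial x_{i+1}}\Big)f(x).$$ $x^{(L)}$ denotes the restriction of $x$ to $[-L,L]$ ($x^{(L)}_i=x_i$ for $|i|\le L$, $0$ otherwise). For configurations of finite total energy $E_i(x)=\sum_{\ell\ge i}x_\ell$; for general $x$ the difference $E_n(x)-E_i(x)$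 means $\sum_{j=n}^{i-1}x_j$ if $n\le i$ and $-\sum_{j=i}^{n-1}x_j$ if $n>i$. SIP$(k)$ on $\mathbb Z$ is the jump process on $\mathbb N^{\mathbb Z}$ (finite configurations) with generator $\sum_{i\in\mathbb Z}[\xi_i(2k+\xi_{i+1})(f(\xi^{i,i+1})-f(\xi))+\xi_{i+1}(2k+\xi_i)(f(\xi^{i+1,i})-f(\xi))]$, $\xi^{i,j}$ being $\xi$ with one particle moved from $i$ to $j$. Put $$D^\sigma(x,\xi)=\prod_{i\in\mathbb Z}\frac{\Gamma(2k)}{\Gamma(2k+\xi_i)}\Big(\frac{e^{-2\sigma E_{i+1}(x)}-e^{-2\sigma E_i(x)}}{2\sigma}\Big)^{\xi_i}.$$ $x\in\mathbb R_+^{\mathbb Z}$ is a good infinite-volume configuration for ABEP$(\sigma,k)$ if $\lim_{L\to\infty}\prod_{i\in\mathbb Z}e^{2\sigma\xi_iE_{i+1}(x^{(L)})}\,\mathbb E_\xi[D^\sigma(x^{(L)},\xi(t))]$ exists and is finite for all $t\ge0$ and all $\xi\in\mathbb N^{\mathbb Z}$ with $\sum_i\xi_i<\infty$, where $\xi(t)$ is SIP$(k)$ started from $\xi$. The total integrated current $J_i(t)=E_i(x(t))-E_i(x(0))$ is the total energy crossing the bond $(i-1,i)$ from left to right in $[0,t]$. Infinite-volume expectations are by convention obtained by the limiting procedure $\mathbb E_x[e^{-2\sigma J_i(t)}]:=\lim_{L\to\infty}\mathbb E_{x^{(L)}}\big[e^{-2\sigma(E_i(x(t))-E_i(x^{(L)}))}\big]$.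 *)

(* Defs.v *)
From HB Require Import structures.
From mathcomp Require Import all_boot all_order all_algebra.
From mathcomp Require Import all_classical all_reals all_analysis.
From mathcomp Require Import measurable_realfun.

Set Implicit Arguments.
Unset Strict Implicit.
Unset Printing Implicit Defensive.

Import Order.TTheory GRing.Theory Num.Theory.
Import numFieldNormedType.Exports.

Local Open Scope classical_set_scope.
Local Open Scope ring_scope.

(* Configurations int -> V carry the product sigma-algebra, i.e. the one
   generated by the coordinate maps. *)
Definition coordinate_sets d (V : measurableType d) : set (set (int -> V)) :=
  [set A | exists i (C : set V), measurable C /\ A = (fun x => x i) @^-1` C].

Definition config d (V : measurableType d) := g_sigma_algebraType (@coordinate_sets d V).

Section markov_processes.
Context {R : realType} {d d' : measure_display}
  {Omega : measurableType d} {T : measurableType d'}.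

(* The natural filtration of X at time s. *)
Definition history (X : R -> Omega -> T) (s : R) : set (set Omega) :=
  <<s [set A | exists u (B : set T),
         [/\ 0 <= u <= s, measurable B & A = X u @^-1` B]] >>.

(* A time-homogeneous Markov process with state space S: P x is the law under
   which the process (X t), t >= 0, starts from x.  The values of P outside S
   and of X at negative times are irrelevant. *)
Record markov_process (S : set T) (P : T -> probability Omega R)
    (X : R -> Omega -> T) : Prop := MarkovProcess {
  mp_state : forall (t : R) w, 0 <= t -> S (X t w);
  mp_measurable : forall t : R, 0 <= t -> measurable_fun setT (X t);
  mp_start : forall x, S x -> {ae P x, forall w, X 0 w = x};
  mp_kernel : forall (t : R) (B : set T), 0 <= t -> measurable B ->
    measurable_fun S (fun x => P x (X t @^-1` B));
  mp_markov : forall x (s t : R) (A : set Omega) (B : set T),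
    S x -> 0 <= s -> 0 <= t -> history X s A -> measurable B ->
    P x (A `&` X (s + t) @^-1` B) =
      (\int[P x]_(w in A) P (X s w) (X t @^-1` B))%E }.

(* The generator of the process is L on the test functions D: whenever f in D
   is bounded with L f bounded, T_t f - f = int_0^t T_s (L f) ds, where
   T_t f x = E_x[f(X_t)] is the semigroup of the process. *)
Definition has_generator (S : set T) (D : set (T -> R))
    (L : (T -> R) -> T -> R) (P : T -> probability Omega R)
    (X : R -> Omega -> T) : Prop :=
  forall f, D f -> [bounded f x | x in S] -> [bounded L f x | x in S] ->
  forall x (t : R), S x -> 0 <= t ->
    ('E_(P x)[fun w => f (X t w)] = (f x)%:E +
      \int[lebesgue_measure]_(s in `[0%R, t]) 'E_(P x)[fun w => L f (X s w)])%E.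

End markov_processes.

Definition update (V : Type) (x : int -> V) (i : int) (v : V) : int -> V :=
  fun j => if j == i then v else x j.

Section ABEP.
Variable R : realType.
Implicit Types (x : config R) (f : config R -> R) (i n : int).

Definition finite_energy : set (config R) :=
  [set x | (forall i, 0 <= x i) /\ (\esum_(i in [set: int]) (x i)%:E < +oo)%E].

(* E_i(x); meaningful when the series converges. *)
Definition energy i x : R := limn (series (fun m : nat => x (i + m%:Z))).

(* E_n(x) - E_i(x), for arbitrary x. *)
Definition energy_diff n i x : R :=
  if n <= i then \sum_(0 <= m < `|i - n|%N) x (n + m%:Z)
  else - \sum_(0 <= m < `|n - i|%N) x (i + m%:Z).

Definition truncate (L : nat) x : config R :=
  fun i => if (`|i|%N <= L)%N then x i else 0.

Definition partial i f x : R := derive1 (fun s : R => f (update x i s)) (x i).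

(* d/dx_i - d/dx_{i+1} *)
Definition bond_derivative i f x : R := partial i f x - partial (i + 1) f x.

Definition ABEP_bond (sigma k : R) i f x : R :=
  let a := expR (- 2 * sigma * x i) in
  let b := expR (2 * sigma * x (i + 1)) in
  (4 * sigma ^+ 2)^-1 * (1 - a) * (b - 1)
      * bond_derivative i (bond_derivative i f) x
  - (2 * sigma)^-1 * ((1 - a) * (b - 1) + 2 * k * (2 - a - b))
      * bond_derivative i f x.

Definition ABEP_generator (sigma k : R) f x : R :=
  \sum_(i \in [set: int]) ABEP_bond sigma k i f x.

Definition C2 (m : nat) (phi : 'rV[R]_m.+1 -> R) : Prop :=
  forall v w : 'rV[R]_m.+1,
    [/\ forall y, derivable phi y v,
        continuous ('D_v phi),
        forall y, derivable ('D_v phi) y w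
      & continuous ('D_w ('D_v phi))].

(* C^2 functions of finitely many of the variables E_j; since
   x_j = E_j - E_{j+1}, these include the local C^2 functions.  For such f only
   finitely many bonds contribute to the generator on finite_energy. *)
Definition ABEP_test : set (config R -> R) :=
  [set f | exists (m : nat) (n : int) (phi : 'rV[R]_m.+1 -> R),
     C2 phi /\ f = fun x => phi (\row_(j < m.+1) energy (n + j%:Z) x)].

Definition is_ABEP d (Omega : measurableType d) (sigma k : R)
    (P : config R -> probability Omega R) (X : R -> Omega -> config R) : Prop :=
  [/\ markov_process finite_energy P X,
      forall w i, {within [set t : R | 0 <= t], continuous (fun t => X t w i)}
    & has_generator finite_energy ABEP_test (ABEP_generator sigma k) P X].

End ABEP.

Section SIP.
Variable R : realType.
Implicit Types (xi : config nat) (f : config nat -> R) (i j : int).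

Definition finite_particles : set (config nat) :=
  [set xi | finite_set [set i | xi i != 0%N]].

(* xi^{i,j}; only relevant for i != j and 0 < xi i. *)
Definition move i j xi : config nat :=
  update (update xi i (xi i).-1) j (xi j).+1.

Definition SIP_generator (k : R) f xi : R :=
  \sum_(i \in [set: int])
    ((xi i)%:R * (2 * k + (xi (i + 1))%:R) * (f (move i (i + 1) xi) - f xi)
     + (xi (i + 1))%:R * (2 * k + (xi i)%:R) * (f (move (i + 1) i xi) - f xi)).

(* Right-continuity is with respect to the discrete topology on the countable
   set finite_particles. *)
Definition is_SIP d (Omega : measurableType d) (k : R)
    (P : config nat -> probability Omega R) (X : R -> Omega -> config nat) : Prop :=
  [/\ markov_process finite_particles P X,
      forall w (t : R), 0 <= t -> \forall s \near t^'+, X s w = X t w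
    & has_generator finite_particles setT (SIP_generator k) P X].

End SIP.

Section duality.
Variable R : realType.

Definition Gamma (z : R) : R :=
  \int[lebesgue_measure]_(s in `]0, +oo[) (s `^ (z - 1) * expR (- s)).

Definition dual_D (sigma k : R) (x : config R) (xi : config nat) : R :=
  \big[*%R/1]_(i \in [set: int])
    (Gamma (2 * k) / Gamma (2 * k + (xi i)%:R) *
     ((expR (- 2 * sigma * energy (i + 1) x) - expR (- 2 * sigma * energy i x))
        / (2 * sigma)) ^+ xi i).

Definition good_configuration d (Omega : measurableType d) (sigma k : R)
    (P : config nat -> probability Omega R) (X : R -> Omega -> config nat)
    (x : config R) : Prop :=
  (forall i, 0 <= x i) /\
  forall (t : R) (xi : config nat), 0 <= t -> finite_particles xi ->
  exists l : R,
    ((\big[*%R/1%R]_(i \in [set: int])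
         expR (2 * sigma * (xi i)%:R * energy (i + 1) (truncate L x)))%:E *
      'E_(P xi)[fun w => dual_D sigma k (truncate L x) (X t w)])%E
    @[L --> \oo] --> l%:E.

Definition besselI (n : nat) (z : R) : R :=
  limn (series (fun m : nat =>
    (z / 2) ^+ (2 * m + n)%N / (m`! * (m + n)`!)%N%:R)).

End duality.

(* Main.v *)
Require Import Defs.
From HB Require Import structures.
From mathcomp Require Import finmap.
From mathcomp Require Import all_boot all_order all_algebra.
From mathcomp Require Import all_classical all_reals all_analysis.
From mathcomp Require Import measurable_realfun ring lra zify.
Import Order.TTheory GRing.Theory Num.Theory.
Import numFieldNormedType.Exports.
Local Open Scope classical_set_scope.
Local Open Scope ring_scope.

(* The variable u_n = exp(-2 sigma E_n) is a smooth function of a single energy,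
   only the bond (n-1,n) acts on it, and the generator gives
     L u_n = 2k (u_(n+1) + u_(n-1) - 2 u_n).
   Hence E[u_n(x(t))] is a bounded solution of the heat equation on Z.  After
   multiplication by exp(4kt) such a solution g satisfies
   y_n' = 2k (y_(n+1) + y_(n-1)); Taylor expansion at 0 with a remainder bounded
   by a multiple of (4kt)^N / N! yields
     exp(4kt) g_n(t) = sum_m g_m(0) I_|m-n|(4kt),
   which is the formula for every configuration of finite energy.  The same
   argument, applied to the indicator of "one particle, sitting at n", gives the
   law exp(-4kt) I_|n-a|(4kt) of one SIP particle started from a.

   Goodness is only used with one particle, started from i-1: bounding
   E[D] below by the one-particle configurations shows that
     sum_m I_m(4kt) (W_(i+m) - W_(i+m-1)) < oo,  W_n = exp(-2 sigma (E_n - E_i)),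
   and since I_(m+r)(z) <= I_m(z) (z/2)^r / r!, a summation by parts turns this
   into sum_n W_n I_|n-i|(4kt) < oo.  That sum, increased by
   sum_n I_|n-i|(4kt), dominates the truncated ones. *)

(** * Integrals of bounded functions *)

(** The integral of a nonnegative function is a supremum over the simple functions below its
    extension by zero, so the comparison is valid for nonmeasurable [f] and [g] as well. *)
Lemma le_ge0_integral d (T : measurableType d) (R : realType)
    (mu : {measure set T -> \bar R}) (A B : set T) (f g : T -> \bar R) :
  A `<=` B -> (forall x, A x -> (0 <= f x)%E) -> (forall x, B x -> (0 <= g x)%E) ->
  (forall x, A x -> (f x <= g x)%E) ->
  (\int[mu]_(x in A) f x <= \int[mu]_(x in B) g x)%E.
Proof.
move=> AB f0 g0 fg; rewrite !ge0_integralE//; apply: le_ereal_sup => _ [h hf <-].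
exists h => // x; apply: (le_trans (hf x)); rewrite !patchE.
case: ifPn => [/[!inE] Ax|_]; first by rewrite mem_set ?fg//; exact: AB.
by case: ifPn => // /[!inE]; exact: g0.
Qed.

Section heat.
Context {R : realType}.
Notation mu := lebesgue_measure.

(* [h] is not assumed measurable: the integrals of its positive and negative
   parts over [0, t] are monotone in [t] all the same, as suprema over simple
   functions. *)
Lemma bounded_primitive_measurable (h g : R -> R) (C : R) :
  (forall s, 0 <= s -> `|h s| <= C) ->
  (forall t, 0 <= t ->
    (g t)%:E = ((g 0)%:E + \int[mu]_(s in `[0%R, t]) (h s)%:E)%E) ->
  measurable_fun (`[0, +oo[ : set R) g.
Proof.
move=> hC gE.
have C0 : 0 <= C by apply: le_trans (hC 0 _).
pose F (u : R -> \bar R) t : \bar R := (\int[mu]_(s in `[0%R, t]) u s)%E.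
pose E := EFin \o h.
have posC u t : (forall s, 0 <= s -> (0 <= u s <= C%:E)%E) -> F u t \is a fin_num.
  move=> uC; apply/fin_numP; rewrite gt_eqF; last first.
    apply: (@lt_le_trans _ _ 0%E) => //; apply: integral_ge0 => s /=.
    by rewrite in_itv/= => /andP[/uC/andP[]].
  rewrite lt_eqF//; apply: (@le_lt_trans _ _ (\int[mu]_(s in `[0%R, t]) C%:E)%E).
    apply: le_ge0_integral => // s /=; rewrite in_itv/= => /andP[/uC/andP[//]].
  rewrite integral_cst//= lebesgue_measure_itv/=; case: ifP => _.
    by rewrite -EFinB -EFinM ltry.
  by rewrite mule0 ltry.
have monF u : (forall s, 0 <= s -> (0 <= u s <= C%:E)%E) ->
    nondecreasing_fun (fine \o F u).
  move=> uC s t st /=; apply: fine_le; [exact: posC|exact: posC|].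
  apply: le_ge0_integral => //.
  - by move=> x /=; rewrite !in_itv/= => /andP[-> xs]/=; exact: le_trans st.
  - by move=> x /=; rewrite in_itv/= => /andP[/uC/andP[]].
  - by move=> x /=; rewrite in_itv/= => /andP[/uC/andP[]].
have Ep s : 0 <= s -> (0 <= (E^\+)%E s <= C%:E)%E.
  move=> s0; rewrite funepos_ge0/= funeposE /E/=.
  by rewrite -EFin_max lee_fin ge_max C0 andbT (le_trans (ler_norm _))// hC.
have En s : 0 <= s -> (0 <= (E^\-)%E s <= C%:E)%E.
  move=> s0; rewrite funeneg_ge0/= funenegE /E/=.
  by rewrite -EFin_max lee_fin ge_max C0 andbT (le_trans (ler_norm _))// normrN hC.
apply: (@eq_measurable_fun _ _ _ _ _
   (fun t => g 0 + (fine (F (E^\+)%E t) - fine (F (E^\-)%E t)))).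
  move=> t; rewrite inE/= in_itv/= andbT => t0.
  apply: EFin_inj; rewrite gE// integralE EFinD EFinB !fineK//; exact: posC.
apply: measurable_funS (measurableT) _ _ => //.
apply: measurable_funD => //; apply: measurable_funB;
  by apply: nondecreasing_measurable => //; exact: monF.
Qed.

Section primitive.
Variables (h g : R -> R) (C : R).
Hypothesis mh : measurable_fun (`[0, +oo[ : set R) h.
Hypothesis hC : forall s, 0 <= s -> `|h s| <= C.
Hypothesis gE : forall t, 0 <= t ->
  (g t)%:E = ((g 0)%:E + \int[mu]_(s in `[0%R, t]) (h s)%:E)%E.

Lemma bounded_integrable_itv (T : R) : mu.-integrable `[0, T] (EFin \o h).
Proof.
apply: measurable_bounded_integrable => //.
- by rewrite /= lebesgue_measure_itv/=; case: ifP => _; rewrite ?ltry// -EFinB ltry.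
- apply: measurable_funS mh => // x /=; rewrite !in_itv/= andbT.
  by case/andP.
- exists C; split; first exact: num_real.
  move=> M CM s; rewrite /= in_itv/= => /andP[s0 _].
  by rewrite (le_trans (hC s s0))// ltW.
Qed.

Lemma primitiveE t : 0 <= t -> g t = g 0 + \int[mu]_(s in `[0, t]) h s.
Proof.
move=> t0; apply: EFin_inj; rewrite gE// EFinD; congr (_ + _)%E.
rewrite /Rintegral fineK//; apply: integrable_fin_num => //.
exact: bounded_integrable_itv.
Qed.

Lemma primitive_continuous T : 0 <= T -> {within `[0, T], continuous g}.
Proof.
move=> T0; have cF := parameterized_integral_continuous T0 (bounded_integrable_itv T).
apply: (@subspace_eq_continuous R `[0, T] R (fun t => g 0 + \int[mu]_(s in `[0, t]) h s)).
  by move=> t; rewrite inE/= in_itv/= => /andP[t0 _]; rewrite -primitiveE.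
move=> x; apply: (@continuousD R R (subspace `[0, T]) (cst (g 0))).
  exact: cst_continuous.
exact: cF.
Qed.

Lemma primitive_is_derive x : 0 < x -> {for x, continuous h} ->
  is_derive x 1 g (h x).
Proof.
move=> x0 hx.
have x1 : x < x + 1 by rewrite ltrDl.
have [dF F'] := continuous_FTC1_closed x1 (bounded_integrable_itv _) x0 hx.
have nr : \near x, g 0 + \int[mu]_(s in `[0, x]) h s = g x.
  near=> y; rewrite -primitiveE//; near: y.
  by apply: filterS (lt_nbhsr x0) => y /ltW.
have dG : is_derive x 1 (fun t => g 0 + \int[mu]_(s in `[0, t]) h s) (h x).
  have -> : h x = 0 + h x by rewrite add0r.
  apply: (@is_deriveD _ _ _ (cst (g 0))).
  by split => //; rewrite -derive1E.
exact: near_eq_is_derive nr dG.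
Unshelve. all: by end_near. Qed.

End primitive.

End heat.

(** * The lattice heat equation *)

(** The [r]-th power of the adjacency operator of Z. Up to the factor c^r / r!, its values at the
    initial data are the Taylor coefficients at 0 of a solution of y_n' = c (y_(n+1) + y_(n-1)). *)
Fixpoint neighbour_sum (R : realType) (a : int -> R) (r : nat) (n : int) : R :=
  if r is r'.+1 then neighbour_sum R a r' (n + 1) + neighbour_sum R a r' (n - 1)
  else a n.
Arguments neighbour_sum {R}.

Section heat.
Context {R : realType}.
Notation mu := lebesgue_measure.

(** Both [phi + f] and [phi - f] vanish at 0 and have nonnegative derivative, hence are
    nonnegative. *)
Lemma norm_le_of_derive (f phi df dphi : R -> R) (T : R) :
  f 0 = 0 -> phi 0 = 0 ->
  {within `[0, T], continuous f} -> {within `[0, T], continuous phi} ->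
  (forall x, 0 < x < T -> is_derive x 1 f (df x)) ->
  (forall x, 0 < x < T -> is_derive x 1 phi (dphi x)) ->
  (forall x, 0 < x < T -> `|df x| <= dphi x) ->
  forall t, 0 <= t <= T -> `|f t| <= phi t.
Proof.
move=> f0 phi0 cf cphi Df Dphi dle t /andP[t0 tT].
have T0 : 0 <= T by apply: le_trans tT.
have H (u du : R -> R) : u 0 = 0 -> {within `[0, T], continuous u} ->
    (forall x, 0 < x < T -> is_derive x 1 u (du x)) ->
    (forall x, 0 < x < T -> 0 <= du x) -> 0 <= u t.
  move=> u0 cu Du du0; rewrite -[leLHS]u0.
  apply: (@ger0_derive1_ndecr _ _ 0 T) => //.
  - by move=> x; rewrite in_itv/= => /Du[].
  - move=> x; rewrite in_itv/= => xT; have Dx := Du x xT.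
    by rewrite derive1E derive_val du0.
rewrite ler_norml; apply/andP; split.
- rewrite -subr_ge0 opprK; apply: (H (f + phi) (df + dphi)) => //.
  + by rewrite fctE f0 phi0 addr0.
  + by move=> x; apply: (@continuousD R R (subspace `[0, T]) f phi); [exact: cf|exact: cphi].
  + by move=> x xT; apply: is_deriveD; [exact: Df|exact: Dphi].
  + move=> x xT; rewrite fctE; have := dle x xT; rewrite ler_norml.
    by move=> /andP[? _]; lra.
- rewrite -subr_ge0; apply: (H (phi - f) (dphi - df)) => //.
  + by rewrite !fctE f0 phi0 subr0.
  + by move=> x; apply: (@continuousB R R (subspace `[0, T]) phi f); [exact: cphi|exact: cf].
  + by move=> x xT; apply: is_deriveB; [exact: Dphi|exact: Df].
  + move=> x xT; rewrite !fctE; have := dle x xT; rewrite ler_norml.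
    by move=> /andP[_ ?]; lra.
Qed.

Lemma is_derive_expn_fact (b : R) (r : nat) (t : R) :
  is_derive t 1 (fun s => (b * s) ^+ r.+1 / r.+1`!%:R) (b * ((b * t) ^+ r / r`!%:R)).
Proof.
have -> : (fun s => (b * s) ^+ r.+1 / r.+1`!%:R) =
    (b ^+ r.+1 / r.+1`!%:R) *: ((@id R) ^+ r.+1).
  by apply/funext => s; rewrite !fctE /= exprMn/= /GRing.scale/= mulrAC.
apply: is_derive_eq.
rewrite /= exprMn factS natrM exprS.
have r0 : r`!%:R != 0 :> R by rewrite pnatr_eq0 -lt0n fact_gt0.
rewrite /GRing.scale/= mulr1 -mulr_natl.
by field; rewrite r0 addrC natr1 pnatr_eq0.
Qed.

(** * Taylor expansion of bounded solutions, from regularity to the remainder *)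

Section lattice.
Variables (c : R) (g : int -> R -> R).
Hypothesis c0 : 0 <= c.
Hypothesis g1 : forall n (t : R), 0 <= t -> `|g n t| <= 1.
Let h n (s : R) := c * (g (n + 1) s + g (n - 1) s - 2 * g n s).
Hypothesis gE : forall n (t : R), 0 <= t ->
  (g n t)%:E = ((g n 0)%:E + \int[mu]_(s in `[0%R, t]) (h n s)%:E)%E.

Let hC n (s : R) : 0 <= s -> `|h n s| <= c * 4.
Proof.
move=> s0; rewrite normrM (ger0_norm c0) ler_wpM2l//.
have := g1 n s s0; have := g1 (n + 1) s s0; have := g1 (n - 1) s s0.
by rewrite !ler_norml => /andP[? ?] /andP[? ?] /andP[? ?]; apply/andP; split; lra.
Qed.

(** Start of a bootstrap: [g n] is measurable as a primitive of a bounded function, so [h n] is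
    measurable, so [g n] is continuous, so [h n] is continuous at positive times and is the
    derivative of [g n] there. *)
Let mg n : measurable_fun (`[0, +oo[ : set R) (g n).
Proof. exact: (bounded_primitive_measurable _ _ _ (hC n) (gE n)). Qed.

Let mh n : measurable_fun (`[0, +oo[ : set R) (h n).
Proof.
apply: measurable_funM => //; apply: measurable_funB.
  by apply: measurable_funD.
by apply: measurable_funM.
Qed.

Let cg n (T : R) : 0 <= T -> {within `[0, T], continuous (g n)}.
Proof. exact: (primitive_continuous _ _ _ (mh n) (hC n) (gE n)). Qed.

Let cgt n (x : R) : 0 < x -> {for x, continuous (g n)}.
Proof.
move=> x0; have x1 : 0 < x + 1 by rewrite addr_gt0.
have /(continuous_within_itvP _ x1)[cgo _ _] := cg n (x + 1) (ltW x1).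
by apply: cgo; rewrite in_itv/= x0 ltrDl/=.
Qed.

Let Dg n (x : R) : 0 < x -> is_derive x 1 (g n) (h n x).
Proof.
move=> x0; apply: (primitive_is_derive _ _ _ (mh n) (hC n) (gE n)) => //.
rewrite /h; apply: cvgM; first exact: cvg_cst.
apply: cvgB; first by apply: cvgD; exact: cgt.
by apply: cvgM; [exact: cvg_cst|exact: cgt].
Qed.

Let y n (t : R) := expR (2 * c * t) * g n t.

Let Dy n (x : R) : 0 < x -> is_derive x 1 (y n) (c * (y (n + 1) x + y (n - 1) x)).
Proof.
move=> x0.
have De : is_derive x 1 (fun t => expR (2 * c * t)) (2 * c * expR (2 * c * x)).
  have D1 : is_derive x 1 (fun t : R => 2 * c * t) (2 * c).
    apply: is_derive_eq (is_deriveZ (2 * c) (is_derive_id x (1 : R))) _.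
    by rewrite /GRing.scale/= mulr1.
  have D2 := @is_derive1_comp _ expR (fun t => 2 * c * t) _ _ _
    (is_derive_expR (2 * c * x)) D1.
  by apply: is_derive_eq D2 _; rewrite mulrC.
apply: is_derive_eq (is_deriveM De (Dg n x x0)) _.
by rewrite /GRing.scale/= /y /h; ring.
Qed.

Let cy n (T : R) : 0 <= T -> {within `[0, T], continuous (y n)}.
Proof.
move=> T0 x; apply: (@continuousM R (subspace `[0, T]) (fun t => expR (2 * c * t)) (g n)); last exact: cg.
apply: continuous_subspaceT => z.
apply: continuous_comp; last exact: continuous_expR.
exact: mulrl_continuous.
Qed.

(** The first [N] terms of the Taylor expansion of [y n] at 0. These polynomials satisfy the
    equation of [y], with one term lost at each differentiation. *)
Let P N n (t : R) := \sum_(r < N) (c * t) ^+ r / r`!%:R * neighbour_sum (g^~ 0) r n.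

Let DP N n (t : R) : is_derive t 1 (P N.+1 n) (c * (P N (n + 1) t + P N (n - 1) t)).
Proof.
elim: N => [|N IH].
  have -> : P 1%N n = cst (g n 0).
    by apply/funext => s; rewrite /P big_ord1 expr0 fact0 divr1 mul1r.
  by rewrite /P !big_ord0 addr0 mulr0; exact: is_derive_cst.
have -> : P N.+2 n = P N.+1 n + neighbour_sum (g^~ 0) N.+1 n *:
    (fun s => (c * s) ^+ N.+1 / N.+1`!%:R).
  by apply/funext => s; rewrite /P big_ord_recr/=; congr (_ + _); exact: mulrC.
have := is_deriveD IH (is_deriveZ (neighbour_sum (g^~ 0) N.+1 n)
  (is_derive_expn_fact c N t)) => D.
apply: is_derive_eq D _; rewrite /P ![in RHS]big_ord_recr/= /GRing.scale/=.
by ring.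
Qed.

(** Induction on [N]: the remainder vanishes at 0, and its derivative is [c] times the sum of the
    previous remainders at the two neighbours, which is where 2c comes from. Fixing the horizon [T]
    keeps the constant [expR (2 * c * T)] the same throughout the induction. *)
Lemma lattice_heat_taylor N n (t T : R) : 0 <= t <= T ->
  `|expR (2 * c * t) * g n t - P N n t| <=
    expR (2 * c * T) * ((2 * c * t) ^+ N / N`!%:R).
Proof.
move=> tT; have T0 : 0 <= T by case/andP: tT; exact: le_trans.
elim: N n t tT => [|N IH] n t tT.
  case/andP: tT => t0 tT.
  rewrite /P big_ord0 subr0 expr0 fact0 divr1 mulr1 normrM ger0_norm ?expR_ge0//.
  rewrite -[leRHS]mulr1 ler_pM ?expR_ge0 ?g1//.
  by rewrite ler_expR ler_wpM2l// mulr_ge0.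
apply: (norm_le_of_derive (y n - P N.+1 n)
  (expR (2 * c * T) *: (fun s => (2 * c * s) ^+ N.+1 / N.+1`!%:R))
  (fun x => c * (y (n + 1) x + y (n - 1) x) - c * (P N (n + 1) x + P N (n - 1) x))
  (fun x => expR (2 * c * T) * (2 * c * ((2 * c * x) ^+ N / N`!%:R))) T _ _ _ _ _ _ _ t tT).
- rewrite !fctE /y /P mulr0 expR0 mul1r big_ord_recl/= big1 => [|i _].
    by rewrite expr0 fact0 divr1 mul1r addr0 subrr.
  by rewrite mulr0 expr0n/= mul0r mul0r.
- by rewrite !fctE mulr0 expr0n/= mul0r scaler0.
- move=> x; apply: (@continuousB R R (subspace `[0, T]) (y n) (P N.+1 n)); first exact: cy.
  apply: continuous_subspaceT => z; apply: differentiable_continuous.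
  by apply/derivable1_diffP; case: (DP N n z).
- apply: continuous_subspaceT => z; apply: differentiable_continuous.
  by apply/derivable1_diffP; case: (is_deriveZ (expR (2 * c * T)) (is_derive_expn_fact (2 * c) N z)).
- move=> x /andP[x0 _]; apply: is_deriveB; first exact: Dy.
  exact: DP.
- by move=> x _; exact: (is_deriveZ (expR (2 * c * T)) (is_derive_expn_fact (2 * c) N x)).
- move=> x /andP[x0 xT].
  have xT' : 0 <= x <= T by rewrite !ltW.
  rewrite -mulrBr normrM (ger0_norm c0).
  have := IH (n + 1) x xT'; have := IH (n - 1) x xT'.
  rewrite -/(y _ x) -/(y _ x) => A B.
  rewrite [leRHS](_ : _ = c * (expR (2 * c * T) * ((2 * c * x) ^+ N / N`!%:R) +
    expR (2 * c * T) * ((2 * c * x) ^+ N / N`!%:R))); last by ring.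
  rewrite ler_wpM2l//; apply: le_trans (lerD B A).
  apply: le_trans (ler_normD _ _); rewrite le_eqVlt; apply/orP; left; apply/eqP.
  by congr `|_|; ring.
Qed.

(** With [T := t] the remainder bound is a constant times the general term of an exponential series,
    which tends to 0. *)
Lemma lattice_heat_series n (t : R) : 0 <= t ->
  (\sum_(r < N) (c * t) ^+ r / r`!%:R * neighbour_sum (g^~ 0) r n) @[N --> \oo]
    --> expR (2 * c * t) * g n t.
Proof.
move=> t0; apply/cvgrPdist_le => e e0.
have := @cvg_exp_coeff R (2 * c * t) => /cvgrPdist_le.
have ee : 0 < e / expR (2 * c * t) by rewrite divr_gt0// expR_gt0.
move=> /(_ _ ee); apply: filterS => N; rewrite sub0r normrN => le_e.
have tt : 0 <= t <= t by rewrite t0 lexx.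
apply: (le_trans (lattice_heat_taylor N n t t tt)).
rewrite mulrC -ler_pdivlMr ?expR_gt0//; apply: le_trans le_e; exact: ler_norm.
Qed.

End lattice.
End heat.

(** * Rearrangement of sums and Bessel functions *)

Section esum_extra.
Context {R : realType}.

Lemma esum_series (u : nat -> R) (l : R) : (forall n, 0 <= u n) ->
  series u @ \oo --> l -> (\esum_(n in [set: nat]) (u n)%:E = l%:E)%E.
Proof.
move=> u0 ul; rewrite -nneseries_esumT; last by move=> n; rewrite lee_fin.
apply/cvg_lim => //.
have -> : (fun n => \sum_(0 <= k < n) (u k)%:E)%E = EFin \o series u.
  by apply/funext => n /=; rewrite sumEFin.
apply: cvg_EFin; last exact: ul.
by apply: nearW => n.
Qed.

Lemma esumZl (T : choiceType) (A : set T) (c : R) (f : T -> R) : 0 <= c ->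
  (forall i, A i -> 0 <= f i) ->
  (\esum_(i in A) (c * f i)%:E = c%:E * \esum_(i in A) (f i)%:E)%E.
Proof.
have H (b : R) (h : T -> R) : 0 < b ->
    (\esum_(i in A) (b * h i)%:E <= b%:E * \esum_(i in A) (h i)%:E)%E.
  move=> b0; apply: ge_ereal_sup => _ [X [finX XA] <-].
  rewrite (_ : \sum_(i \in X) _ = b%:E * \sum_(i \in X) (h i)%:E)%E; last first.
    by rewrite !fsbig_finite//= !sumEFin -EFinM mulr_sumr.
  rewrite lee_pmul2l//.
  by apply: ereal_sup_ubound; exists X.
rewrite le_eqVlt => /predU1P[<- _|c0 f0].
  by rewrite mul0e esum1// => i _; rewrite mul0r.
(* The reverse inequality is [H] for the factor [c^-1] and the function [c * f]. *)
apply/eqP; rewrite eq_le H//=.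
rewrite -(@lee_pmul2l _ c^-1%:E)// ?lte_fin ?invr_gt0// muleA -EFinM mulVf ?gt_eqF// mul1e.
have ci : 0 < c^-1 by rewrite invr_gt0.
apply: le_trans (H _ _ ci); apply: le_esum => i Ai.
by rewrite mulrA mulVf ?gt_eqF// mul1r.
Qed.

(** Reindexing by the bijection from pairs [(r, j)] with j <= r to pairs [(j, r - j)], as in a
    Cauchy product. *)
Lemma esum_antidiagonal (w : nat -> nat -> \bar R) :
  (forall j l, (0 <= w j l)%E) ->
  (\esum_(r in [set: nat]) \sum_(j < r.+1) w j (r - j)%N =
   \esum_(p in [set: nat * nat]) w p.1 p.2)%E.
Proof.
move=> w0.
under eq_esum => r _.
  rewrite (@fsbig_ord _ _ _ r.+1 (fun j => w j (r - j)%N)) -esum_fset//.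
  over.
rewrite esum_esum//.
rewrite (@reindex_esum R _ _ ([set: nat] `*`` (fun r => `I_r.+1)) setT
   (fun k => (k.2, k.1 - k.2)%N) (fun p => w p.1 p.2))//.
split => //.
- move=> [r j] [r' j'] /= /set_mem[_ /= jr] /set_mem[_ /= jr'] [e1 e2].
  by congr pair; move: jr jr' e1 e2; rewrite /= !ltnS; lia.
- move=> [j l] _; exists ((j + l)%N, j) => /=; last by rewrite addKn.
  by split => //=; rewrite ltnS leq_addr.
Qed.

(** Pairs [(j, l)] are grouped by m = l - j, and q is the smaller entry. For products of exponential
    coefficients the inner sum over q is the series of I_|m|. *)
Lemma esum_difference (w : nat -> nat -> \bar R) :
  (forall j l, (0 <= w j l)%E) ->
  (\esum_(p in [set: nat * nat]) w p.1 p.2 =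
   \esum_(m in [set: int]) \esum_(q in [set: nat])
     if (0 <= m)%R then w q (q + `|m|)%N else w (q + `|m|)%N q)%E.
Proof.
move=> w0; rewrite esum_esum; last by move=> i j _ _; case: ifP.
rewrite (@reindex_esum R _ _ ([set: int] `*`` (fun=> [set: nat])) setT
   (fun k => if 0 <= k.1 then (k.2, k.2 + `|k.1|)%N else (k.2 + `|k.1|, k.2)%N)
   (fun p => w p.1 p.2))//.
  by apply: eq_esum => -[m q] _ /=; case: ifP.
split => //.
- move=> [m q] [m' q'] _ _ /=; case: ifPn => m0; case: ifPn => m0' [e1 e2];
    by congr pair; lia.
- move=> [j l] _; exists (l%:Z - j%:Z, minn j l) => //=.
  by case: ifPn => jl; congr pair; lia.
Qed.

End esum_extra.

Section bessel.
Context {R : realType}.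

Lemma besselI_term_ge0 (n m : nat) (z : R) : 0 <= z ->
  0 <= (z / 2) ^+ (2 * m + n)%N / (m`! * (m + n)`!)%N%:R.
Proof. by move=> z0; rewrite divr_ge0// exprn_ge0// divr_ge0. Qed.

(** Since m! (m + n)! >= m!, the series is dominated by (z/2)^n times the exponential series of
    (z/2)^2. *)
Lemma besselI_cvg (n : nat) (z : R) : 0 <= z ->
  series (fun m => (z / 2) ^+ (2 * m + n)%N / (m`! * (m + n)`!)%N%:R) @ \oo
    --> besselI n z.
Proof.
move=> z0; pose a := (z / 2) ^+ 2.
have a0 : 0 <= a by rewrite exprn_ge0// divr_ge0.
have b0 : 0 <= (z / 2) ^+ n by rewrite exprn_ge0// divr_ge0.
apply: (@series_le_cvg _ _ ((z / 2) ^+ n *: exp_coeff a)).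
- by move=> m; exact: besselI_term_ge0.
- by move=> m; rewrite !fctE mulr_ge0// exp_coeff_ge0.
- move=> m; rewrite exprD exprM -/a mulrAC mulrC; apply: ler_wpM2l => //.
  apply: ler_wpM2l; first exact: exprn_ge0.
  rewrite lef_pV2 ?posrE ?ltr0n ?muln_gt0 ?fact_gt0// ler_nat.
  by rewrite leq_pmulr// fact_gt0.
- exact/is_cvg_seriesZ/is_cvg_series_exp_coeff.
Qed.

Lemma besselI_esum (n : nat) (z : R) : 0 <= z ->
  ((besselI n z)%:E = \esum_(m in [set: nat])
    ((z / 2) ^+ (2 * m + n)%N / (m`! * (m + n)`!)%N%:R)%:E)%E.
Proof.
move=> z0; rewrite (esum_series _ (besselI n z))//; last exact: besselI_cvg.
by move=> m; exact: besselI_term_ge0.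
Qed.

Lemma besselI_ge0 (n : nat) (z : R) : 0 <= z -> 0 <= besselI n z.
Proof.
move=> z0; rewrite -lee_fin besselI_esum//; apply: esum_ge0 => m _.
by rewrite lee_fin besselI_term_ge0.
Qed.

End bessel.

(** Binomial expansion of (S + S^-1)^r for the shift S: [j] counts the steps to the left, and
    Pascal's rule drives the induction. *)
Lemma neighbour_sumE (R : realType) (a : int -> R) r n : neighbour_sum a r n =
  \sum_(j < r.+1) 'C(r, j)%:R * a (n + (r - j)%N%:Z - j%:Z).
Proof.
elim: r n => [|r IH] n /=.
  by rewrite big_ord1 bin0 mul1r subnn addr0 subr0.
rewrite !IH [RHS]big_ord_recl /= [X in X + _ = _]big_ord_recl /= -addrA.
rewrite !bin0 !mul1r !subn0 !subr0; congr (a _ + _); first by lia.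
rewrite [in RHS](eq_bigr (fun i : 'I_r.+1 =>
   'C(r, i.+1)%:R * a (n + 1 + (r - i.+1)%N%:Z - i.+1%:Z) +
   'C(r, i)%:R * a (n - 1 + (r - i)%N%:Z - i%:Z))); last first.
  move=> [i ir] _; rewrite /bump/= add1n binS natrD mulrDl subSS; congr (_ + _).
    (* For i = r the truncated subtraction [r - i.+1] gives a wrong index, but the coefficient
       ['C(r, r.+1)] is 0. *)
    have [->|ri] := eqVneq i r; first by rewrite bin_small// !mul0r.
    by congr (_ * a _); lia.
  by congr (_ * a _); lia.
rewrite big_split/=; congr (_ + _).
by rewrite [RHS]big_ord_recr/= bin_small// mul0r addr0.
Qed.

(** With b = ct, the binomial coefficients split b^r / r! into (b^j / j!) (b^l / l!) with j + l = r.
    The Taylor series becomes a double sum over (j, l) in which the initial datum is taken at n + l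
    - j, and grouping by l - j produces Bessel series at 2b. All terms are nonnegative, so the
    rearrangements are legitimate. *)
Lemma lattice_heat_bessel (R : realType) (c : R) (g : int -> R -> R) :
  0 <= c ->
  (forall n (t : R), 0 <= t -> 0 <= g n t <= 1) ->
  (forall n (t : R), 0 <= t ->
    (g n t)%:E = ((g n 0)%:E + \int[lebesgue_measure]_(s in `[0%R, t])
      (c * (g (n + 1) s + g (n - 1) s - 2 * g n s))%:E)%E) ->
  forall n (t : R), 0 <= t ->
  (expR (2 * c * t) * g n t)%:E =
    (\esum_(m in [set: int]) (g m 0 * besselI `|m - n|%N (2 * c * t))%:E)%E.
Proof.
move=> c0 g01 gE n t t0; set b := c * t.
have b0 : 0 <= b by rewrite mulr_ge0.
have g1 m (s : R) : 0 <= s -> `|g m s| <= 1.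
  by move=> /(g01 m) /andP[gs0 gs1]; rewrite ger0_norm.
have a0 m : 0 <= g m 0 by case/andP: (g01 m 0 (lexx _)).
pose w j l := (b ^+ j / j`!%:R * (b ^+ l / l`!%:R) * g (n + l%:Z - j%:Z) 0)%:E.
have w0 j l : (0 <= w j l)%E.
  by rewrite lee_fin !mulr_ge0// ?invr_ge0// exprn_ge0.
pose u r := b ^+ r / r`!%:R * neighbour_sum (g^~ 0) r n.
have uE r : (\sum_(j < r.+1) w j (r - j)%N = (u r)%:E)%E.
  rewrite sumEFin; congr EFin; rewrite /u neighbour_sumE mulr_sumr.
  apply: eq_bigr => -[j jr] _ /=; rewrite [RHS]mulrA; congr (_ * _); rewrite ltnS in jr.
  have nz m : m`!%:R != 0 :> R by rewrite pnatr_eq0 -lt0n fact_gt0.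
  have -> : b ^+ r = b ^+ j * b ^+ (r - j) by rewrite -exprD subnKC.
  rewrite -(bin_fact jr) !natrM; field.
  by rewrite !nz pnatr_eq0 -lt0n bin_gt0.
transitivity (\esum_(r in [set: nat]) \sum_(j < r.+1) w j (r - j)%N)%E.
  under eq_esum => r _ do rewrite uE.
  apply/esym/esum_series.
    by move=> r; rewrite -lee_fin -uE sume_ge0.
  have := lattice_heat_series c g c0 g1 gE n t t0.
  by under eq_fun do rewrite -(big_mkord xpredT
      (fun r => (c * t) ^+ r / r`!%:R * neighbour_sum (g^~ 0) r n)).
rewrite esum_antidiagonal// esum_difference//.
have shiftP : set_bij [set: int] [set: int] (fun m => n + m).
  by split.
rewrite [RHS](@reindex_esum R _ _ _ _ _ _ shiftP).
apply: eq_esum => m _.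
have z0 : 0 <= 2 * c * t by rewrite !mulr_ge0.
have zb : 2 * c * t / 2 = b by rewrite /b; field.
rewrite (_ : n + m - n = m); last by lia.
rewrite EFinM besselI_esum// -esumZl//; last first.
  by move=> q _; rewrite besselI_term_ge0.
apply: eq_esum => q _; rewrite zb /w.
case: ifPn => m0; congr EFin; rewrite mulrC.
  congr (g _ 0 * _); first by lia.
  by rewrite natrM mul2n -addnn -addnA (exprD _ q (q + _)) invfM; ring.
congr (g _ 0 * _); first by lia.
by rewrite natrM mul2n -addnn -addnA (exprD _ q (q + _)) invfM; ring.
Qed.

(** * Positivity of the Gamma function *)

Section gamma.
Context {R : realType} (z : R) (z0 : 0 < z).
Notation mu := (@lebesgue_measure R).
Let f (s : R) : R := s `^ (z - 1) * expR (- s).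

Let f0 s : 0 <= f s.
Proof. by rewrite mulr_ge0 ?powR_ge0 ?expR_ge0. Qed.

Let mf (A : set R) : measurable_fun A f.
Proof.
apply: measurable_funTS; apply: measurable_funM; first exact: measurable_powR.
by apply: measurableT_comp => //; exact: oppr_measurable.
Qed.

(** The constant in s^z <= A exp(s/2), obtained from ln u < u at u = s / (2z). *)
Let A : R := expR (z * ln (2 * z)).

(** From 1 + s^z <= (1 + A) exp(s/2), squared. This bounds the Gamma integrand by a multiple of the
    derivative of the bounded function -(1 + s^z)^-1, which handles the singularity at 0 and the
    tail together. *)
Let expRN_le (s : R) : 0 < s -> expR (- s) <= (1 + A) ^+ 2 * (1 + s `^ z) ^- 2.
Proof.
move=> s0; have z20 : 0 < 2 * z by rewrite mulr_gt0.
have sz : s `^ z <= A * expR (s / 2).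
  rewrite /powR gt_eqF// -expRD ler_expR.
  have lnE : ln s = ln (2 * z) + ln (s / (2 * z)).
    by rewrite -lnM ?posrE ?divr_gt0// mulrC divfK// gt_eqF.
  have lt := @ln_sublinear R _ (divr_gt0 s0 z20).
  have -> : s / 2 = z * (s / (2 * z)) by field; rewrite gt_eqF.
  by rewrite lnE mulrDr lerD2l ler_wpM2l ?(ltW z0)// ltW.
have e1 : 1 <= expR (s / 2) by rewrite -expR0 ler_expR divr_ge0 ?ltW.
have p0 : 0 < 1 + s `^ z by rewrite ltr_wpDr ?powR_ge0.
rewrite ler_pdivlMr ?exprn_gt0// expRN ler_pdivrMl ?expR_gt0//.
have -> : expR s * (1 + A) ^+ 2 = ((1 + A) * expR (s / 2)) ^+ 2.
  by rewrite exprMn -expRM_natl mulrC; congr (_ * expR _); field.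
rewrite ler_sqr ?nnegrE ?(ltW p0) ?mulr_ge0 ?addr_ge0 ?expR_ge0//.
by rewrite mulrDl mul1r lerD.
Qed.

Let F (s : R) : R := - (1 + s `^ z)^-1.
Let dF (s : R) : R := (1 + s `^ z) ^- 2 * (z * s `^ (z - 1)).

Let dF0 s : 0 <= dF s.
Proof.
by rewrite /dF mulr_ge0 ?invr_ge0 ?sqr_ge0// mulr_ge0 ?powR_ge0// ltW.
Qed.

Let DF (s : R) : 0 < s -> is_derive s 1 F (dF s).
Proof.
move=> s0; have p0 : 1 + s `^ z != 0 by rewrite gt_eqF// ltr_wpDr ?powR_ge0.
have D1 : is_derive s 1 (fun s => 1 + s `^ z) (z * s `^ (z - 1)).
  have D := is_deriveD (is_derive_cst (1 : R) s 1) (is_derive1_powR z s0).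
  by apply: is_derive_eq D _; rewrite add0r.
have D2 := is_deriveN (@is_deriveV _ (fun s => 1 + s `^ z) _ _ _ p0 D1).
by apply: is_derive_eq D2 _; rewrite /dF /GRing.scale/= mulNr opprK.
Qed.

Let ctsat (s : R) (h : R -> R) (dh : R) : is_derive s 1 h dh -> {for s, continuous h}.
Proof.
by case=> + _; move=> /derivable1_diffP/differentiable_continuous.
Qed.

Let cdF (s : R) : 0 < s -> {for s, continuous dF}.
Proof.
move=> s0; have p0 : 1 + s `^ z != 0 by rewrite gt_eqF// ltr_wpDr ?powR_ge0.
have cp (a : R) : {for s, continuous (fun s => s `^ a)}.
  exact: ctsat (is_derive1_powR a s0).
have cq : {for s, continuous (fun s => 1 + s `^ z)}.
  by apply: cvgD; [exact: cvg_cst|exact: cp].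
apply: cvgM; last by apply: cvgM; [exact: cvg_cst|exact: cp].
by apply: cvgV; [rewrite expf_eq0|exact: (cvgM cq cq)].
Qed.

(** Compact intervals exhausting the positive half-line; beginning at [n.+2] keeps even the first
    one nondegenerate, as the fundamental theorem of calculus requires. *)
Let D (n : nat) : set R := `[n.+2%:R^-1, n.+2%:R].

Let intD n : (\int[mu]_(s in D n) (f s)%:E <= ((1 + A) ^+ 2 / z)%:E)%E.
Proof.
have n1 : n.+2%:R^-1 < n.+2%:R :> R.
  by apply: (@lt_trans _ _ 1); rewrite ?invf_lt1 ?ltr1n.
have n0 : 0 < n.+2%:R^-1 :> R by rewrite invr_gt0.
have Dpos s : D n s -> 0 < s by rewrite /D/= in_itv/= => /andP[+ _]; exact: lt_le_trans.
have mD : measurable (D n) by exact: measurable_itv.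
have cD : {within D n, continuous dF}.
  by apply: continuous_in_subspaceT => s /set_mem /Dpos; exact: cdF.
have mdF : measurable_fun (D n) dF by exact: subspace_continuous_measurable_fun.
apply: (@le_trans _ _ (\int[mu]_(s in D n) ((1 + A) ^+ 2 / z * dF s)%:E)%E).
  apply: le_ge0_integral => //.
  - by move=> s Ds; rewrite lee_fin.
  - move=> s _; by rewrite lee_fin mulr_ge0// divr_ge0 ?sqr_ge0// ltW.
  - move=> s /Dpos s0; rewrite lee_fin /f /dF.
    rewrite [leRHS](_ : _ = s `^ (z - 1) * ((1 + A) ^+ 2 * (1 + s `^ z) ^- 2)); last first.
      by field; rewrite !gt_eqF// ltr_wpDr ?powR_ge0.
    by rewrite ler_wpM2l ?powR_ge0// expRN_le.
under eq_integral do rewrite EFinM.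
rewrite ge0_integralZl_EFin//; first last.
- by rewrite divr_ge0 ?sqr_ge0 ?ltW.
- exact/measurable_EFinP.
- by move=> s _; rewrite lee_fin !mulr_ge0 ?invr_ge0 ?sqr_ge0 ?powR_ge0 ?(ltW z0).
rewrite (@continuous_FTC2 _ dF F)//; first last.
- move=> s; rewrite in_itv/= => /andP[ns _].
  have s0 : 0 < s by apply: lt_trans ns.
  by have Ds := DF s s0; rewrite derive1E derive_val.
- split.
  + move=> s; rewrite in_itv/= => /andP[ns _].
    by have [] := DF s (lt_trans n0 ns).
  + by apply: cvg_at_right_filter; exact: ctsat (DF _ n0).
  + by apply: cvg_at_left_filter; apply: ctsat (DF _ _).
rewrite -EFinB -EFinM lee_fin -[leRHS]mulr1 ler_wpM2l ?divr_ge0 ?sqr_ge0 ?(ltW z0)//.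
rewrite /F opprK.
have p0 s : 0 <= s `^ z by exact: powR_ge0.
have q0 s : 0 <= (1 + s `^ z)^-1 by rewrite invr_ge0 addr_ge0.
have : (1 + n.+2%:R^-1 `^ z)^-1 <= 1 by rewrite invf_le1 ?lerDl// ltr_wpDr.
by have := q0 n.+2%:R; lra.
Qed.

Let intf_lty : (\int[mu]_(s in `]0%R, +oo[) (f s)%:E < +oo)%E.
Proof.
apply: (@le_lt_trans _ _ ((1 + A) ^+ 2 / z)%:E); last exact: ltry.
have DE : `]0%R, +oo[%classic = \bigcup_n D n.
  apply/seteqP; split => s.
    rewrite /= in_itv/= andbT => s0; set b := Num.max s s^-1.
    have sm : b <= (Num.truncn b).+2%:R.
      by apply: le_trans (ltW (truncnS_gt b)) _; rewrite ler_nat.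
    move: sm; rewrite ge_max => /andP[sm sVm].
    exists (Num.truncn b) => //=; rewrite /D/= in_itv/= sm andbT.
    by rewrite -[leRHS]invrK lef_pV2 ?posrE ?invr_gt0.
  case=> n _; rewrite /D/= !in_itv/= andbT => /andP[+ _].
  by apply: lt_le_trans; rewrite invr_gt0.
have cv : (\int[mu]_(s in D n) (f s)%:E @[n --> \oo] -->
    \int[mu]_(s in \bigcup_n D n) (f s)%:E)%E.
  apply: ge0_nondecreasing_set_cvg_integral.
  - move=> n m nm; rewrite subsetEset => s; rewrite /D/= !in_itv/= => /andP[ns sn].
    apply/andP; split; last by apply: le_trans sn _; rewrite ler_nat !ltnS.
    by apply: le_trans ns; rewrite lef_pV2 ?posrE// ler_nat !ltnS.
  - by move=> n; exact: measurable_itv.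
  - by move=> n; apply/measurable_EFinP; exact: mf.
  - by move=> n s _; rewrite lee_fin.
by rewrite DE; apply: cvge_le cv; apply: nearW => n; exact: intD.
Qed.

(** A real-valued integral defaults to 0 when the extended one is infinite, so positivity takes the
    finiteness [intf_lty] as well as a lower bound. *)
Lemma Gamma_gt0 : 0 < Gamma z.
Proof.
(* On [1, 2] one has s^(z-1) >= s^-1 >= 1/2 and exp(-s) >= exp(-2). *)
pose c : R := 2^-1 * expR (- 2).
have c0 : 0 < c by rewrite mulr_gt0// ?expR_gt0 ?invr_gt0.
have cle : (c%:E <= \int[mu]_(s in `]0%R, +oo[) (f s)%:E)%E.
  apply: (@le_trans _ _ (\int[mu]_(s in `[1%R, 2%R]) c%:E)%E).
    rewrite integral_cst//= lebesgue_measure_itv/= lte_fin ltr1n.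
    by rewrite -EFinB -EFinM lee_fin (_ : 2 - 1 = 1) ?mulr1//; lra.
  apply: le_ge0_integral => //.
  - by move=> s /=; rewrite !in_itv/= andbT => /andP[s1 _]; exact: lt_le_trans s1.
  - by move=> s _; rewrite lee_fin ltW.
  - by move=> s _; rewrite lee_fin.
  - move=> s /=; rewrite in_itv/= => /andP[s1 s2]; rewrite lee_fin /f.
    have s0 : 0 < s by apply: lt_le_trans s1.
    apply: ler_pM; rewrite ?invr_ge0 ?expR_ge0//; last by rewrite ler_expR lerN2.
    apply: (@le_trans _ _ (s `^ (- 1))).
      by rewrite powR_inv1 ?(ltW s0)// lef_pV2 ?posrE.
    by apply: ler_powR => //; rewrite lerDr ltW.
rewrite /Gamma /Rintegral fine_gt0// intf_lty andbT.
by apply: lt_le_trans cle; rewrite lte_fin.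
Qed.

End gamma.

(** * Markov processes with lattice heat observables *)

Section markov_lattice.
Context {R : realType} {d d' : measure_display}
  {Omega : measurableType d} {T : measurableType d'}.
Variables (S : set T) (D : set (T -> R)) (L : (T -> R) -> T -> R).
Variables (P : T -> probability Omega R) (X : R -> Omega -> T).
Variables (c : R) (f : int -> T -> R).
Hypothesis markov_X : markov_process S P X.
Hypothesis generator_X : has_generator S D L P X.
Hypothesis c0 : 0 <= c.
Hypothesis Df : forall n, D (f n).
Hypothesis mf : forall n (t : R), 0 <= t -> measurable_fun setT (fun w => f n (X t w)).
Hypothesis f01 : forall n x, S x -> 0 <= f n x <= 1.
Hypothesis Lf : forall n x, S x ->
  L (f n) x = c * (f (n + 1) x + f (n - 1) x - 2 * f n x).

Let fX_integrable n x (t : R) : 0 <= t ->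
  (P x).-integrable setT (EFin \o (fun w => f n (X t w))).
Proof.
move=> t0; apply: measurable_bounded_integrable => //; last 2 first.
- exact: mf.
- exists 1; split => // M M1 w _; have := f01 n _ (mp_state markov_X w t0).
  by move=> /andP[? ?]; rewrite /= ger0_norm// (le_trans _ (ltW M1)).
- by rewrite /= probability_setT ltry.
Qed.

(** The generator identity turns the expectations of the [f m] into a bounded solution of the
    integrated lattice heat equation. It serves twice: for exponentials of energies under ABEP and
    for the position of one particle under SIP. *)
Lemma expectation_lattice_bessel n x (t : R) : S x -> 0 <= t ->
  ('E_(P x)[fun w => f n (X t w)] = (expR (- (2 * c * t)))%:E *
    \esum_(m in [set: int]) (f m x * besselI `|m - n|%N (2 * c * t))%:E)%E.
Proof.
move=> Sx t0.
pose g m (s : R) : R := \int[P x]_w f m (X s w).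
have intE m s : 0 <= s -> (\int[P x]_w (f m (X s w))%:E = (g m s)%:E)%E.
  by move=> s0; rewrite /g /Rintegral fineK// integrable_fin_num//; exact: fX_integrable.
have gE m s : 0 <= s -> ('E_(P x)[fun w => f m (X s w)] = (g m s)%:E)%E.
  by move=> s0; rewrite unlock intE.
have ELf m s : 0 <= s -> ('E_(P x)[fun w => L (f m) (X s w)] =
    (c * (g (m + 1)%R s + g (m - 1)%R s - 2 * g m s))%:E)%E.
  move=> s0; have I l := fX_integrable l x s s0.
  rewrite unlock (eq_integral (fun w => c%:E *
      (((f (m + 1) (X s w))%:E + (f (m - 1) (X s w))%:E) - 2%:E * (f m (X s w))%:E))%E).
    have I2 := integrableZl measurableT 2 (I m).
    have ID := integrableD measurableT (I (m + 1)) (I (m - 1)).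
    rewrite integralZl//; last exact: (integrableB measurableT ID I2).
    rewrite (integralB measurableT ID I2) integralZl// integralD// !intE//.
  by move=> w _; rewrite Lf//; exact: (mp_state markov_X).
have eqg m s : 0 <= s -> (g m s)%:E = ((f m x)%:E + \int[lebesgue_measure]_(r in `[0%R, s])
      (c * (g (m + 1) r + g (m - 1) r - 2 * g m r))%:E)%E.
  move=> s0; rewrite -gE// (generator_X (f m) (Df m))//.
  - congr (_ + _)%E; apply: eq_integral => r; rewrite inE/= in_itv/= => /andP[r0 _].
    exact: ELf.
  - exists 1; split => // M M1 y Sy; have /andP[? ?] := f01 m y Sy.
    by rewrite /= ger0_norm// (le_trans _ (ltW M1)).
  - exists (c * 4); split; first exact: num_real.
    move=> M M1 y Sy; rewrite /= Lf// (le_trans _ (ltW M1))// normrM (ger0_norm c0) ler_wpM2l//.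
    have /andP[? ?] := f01 m y Sy; have /andP[? ?] := f01 (m + 1) y Sy.
    by have /andP[? ?] := f01 (m - 1) y Sy; rewrite ler_norml; apply/andP; split; lra.
(* At time 0 the integral runs over a single point, so the integrated equation itself gives the
   initial value. *)
have g0 m : g m 0 = f m x.
  by apply: EFin_inj; rewrite eqg// set_itv1 integral_set1 adde0.
have g01 m (s : R) : 0 <= s -> 0 <= g m s <= 1.
  move=> s0; apply/andP; split.
    by apply: Rintegral_ge0 => w _; have /andP[] := f01 m _ (mp_state markov_X w s0).
  rewrite -lee_fin -intE//.
  apply: (@le_trans _ _ (\int[P x]_w 1)%E).
    apply: le_ge0_integral => // w _; rewrite lee_fin;
      by have /andP[] := f01 m _ (mp_state markov_X w s0).
  by rewrite integral_cst//= probability_setT mule1.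
rewrite gE//.
under eq_esum => m _ do rewrite -g0.
rewrite -(lattice_heat_bessel R c g c0 g01 _ n t t0).
  by rewrite -EFinM mulrA expRN mulVf ?mul1r// gt_eqF// expR_gt0.
by move=> m s s0; rewrite g0 eqg.
Qed.

End markov_lattice.

(** * Energies *)

Lemma finite_absz_le (L : nat) : finite_set [set i : int | (`|i| <= L)%N].
Proof.
apply: (sub_finite_set _ (finite_image (fun m : nat => m%:Z - L%:Z : int) (finite_II (2 * L).+1))).
move=> i /= iL; exists (absz (i + L%:Z)) => /=; lia.
Qed.

Section energy.
Context {R : realType}.
Implicit Types (x : config R) (i n : int).

(** Weaker than [finite_energy], and stable under replacing one coordinate by any real number of
    either sign, as differentiation in that coordinate requires. *)
Definition summable_tails x := forall n, cvgn (series (fun m : nat => x (n + m%:Z))).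

Lemma finite_energy_tails x : finite_energy x -> summable_tails x.
Proof.
move=> [x0 xoo] n.
have := @summable_cvg R xpredT (fun m => (x (n + m%:Z))%:E); apply.
  by move=> m _; rewrite lee_fin.
apply: le_lt_trans xoo.
rewrite (eq_esum (b := fun m => (x (n + m%:Z))%:E)); last first.
  by move=> m _; rewrite gee0_abs// lee_fin.
rewrite -(esum_image _ (fun m : nat => n + m%:Z) (fun i => (x i)%:E)); last first.
  by move=> m m' _ _ /addrI[].
rewrite [leRHS](esumID (range (fun m : nat => n + m%:Z))); last first.
  by move=> m _; rewrite lee_fin.
rewrite setTI -set_true leeDl//; apply: esum_ge0 => m _.
by rewrite lee_fin.
Qed.

Lemma energy_cvg x n : summable_tails x ->
  series (fun m : nat => x (n + m%:Z)) @ \oo --> energy n x.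
Proof. exact. Qed.

Lemma update_energy_cvg x n i (s : R) : summable_tails x ->
  series (fun m : nat => update x i s (n + m%:Z)) @ \oo
    --> energy n x + (if n <= i then s - x i else 0).
Proof.
move=> xs; pose v (m : nat) := if n + m%:Z == i then s - x i else 0.
have -> : (fun m : nat => update x i s (n + m%:Z)) = (fun m : nat => x (n + m%:Z)) + v.
  apply/funext => m; rewrite fctE /update /v; case: eqP => [->|_].
    by rewrite addrC subrK.
  by rewrite addr0.
rewrite seriesD; apply: cvgD; first exact: energy_cvg.
have vE N : series v N = if (n <= i) && (i < n + N%:Z) then s - x i else 0.
  elim: N => [|N IH].
    by rewrite /series/= big_nil; case: ifPn => //; lia.
  rewrite seriesSr IH /v; case: eqP => h.
    by rewrite ifF ?add0r ?ifT//; lia.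
  rewrite addr0; congr (if _ then _ else _); lia.
apply: cvg_near_cst; near=> N; rewrite vE; case: (leP n i) => //= ni.
rewrite ifT//; have : (`|i - n|.+1 <= N)%N by near: N; exact: nbhs_infty_ge.
lia.
Unshelve. all: by end_near. Qed.

Lemma update_tails x i (s : R) : summable_tails x -> summable_tails (update x i s).
Proof. by move=> xs n; apply/cvg_ex; eexists; exact: update_energy_cvg. Qed.

Lemma energy_update x n i (s : R) : summable_tails x ->
  energy n (update x i s) = energy n x + (if n <= i then s - x i else 0).
Proof. by move=> xs; apply/cvg_lim => //; exact: update_energy_cvg. Qed.

Lemma energyS x n : summable_tails x -> energy n x = x n + energy (n + 1) x.
Proof.
move=> xs; apply/cvg_lim => //.
rewrite -(cvg_shiftS (series (fun m : nat => x (n + m%:Z))) _).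
rewrite (_ : [sequence _]_n = cst (x n) + series (fun m : nat => x (n + 1 + m%:Z))).
  by apply: cvgD; [exact: cvg_cst|exact: energy_cvg].
apply/funext => N; rewrite fctE /= /series/= big_nat_recl//= addr0; congr (_ + _).
by apply: eq_bigr => m _; congr (x _); lia.
Qed.

Lemma energy_ge0 x n : finite_energy x -> 0 <= energy n x.
Proof.
move=> xs; apply: limr_ge; first exact: (finite_energy_tails x xs).
by apply: nearW => N; apply: sumr_ge0 => m _; case: xs.
Qed.

Lemma energy_diffE x n i : summable_tails x ->
  energy_diff n i x = energy n x - energy i x.
Proof.
move=> xs; have H (N : nat) l : energy l x = \sum_(0 <= m < N) x (l + m%:Z) + energy (l + N%:Z) x.
  elim: N => [|N IH]; first by rewrite big_nil add0r addr0.
  rewrite IH big_nat_recr//= -addrA; congr (_ + _); rewrite energyS//; congr (_ + energy _ x).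
  lia.
rewrite /energy_diff; case: ifPn => ni.
  rewrite (H `|i - n|%N n) (_ : n + `|i - n|%N%:Z = i) ?addrK//; lia.
rewrite (H `|n - i|%N i) (_ : i + `|n - i|%N%:Z = n); last by lia.
by rewrite opprD addrCA subrr addr0.
Qed.

Lemma truncate_finite_energy (L : nat) x : (forall i, 0 <= x i) ->
  finite_energy (truncate L x).
Proof.
move=> x0; have t0 i : 0 <= truncate L x i by rewrite /truncate; case: ifP.
split => //.
rewrite (esumID [set i : int | (`|i| <= L)%N]); last by move=> i _; rewrite lee_fin.
rewrite [X in (_ + X)%E]esum1 => [|i [_ /negP]]; last by rewrite /truncate => /negbTE ->.
rewrite adde0 setTI esum_fset.
- rewrite fsbig_finite/=; first by rewrite sumEFin ltry.
  exact: finite_absz_le.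
- exact: finite_absz_le.
- by move=> i _; rewrite lee_fin.
Qed.

End energy.

(** * The generator of ABEP on exponentials of energies *)

Section ABEP_exponential.
Context {R : realType} (sigma k : R).
Hypothesis sigma0 : 0 < sigma.
Implicit Types (x : config R) (i n : int).

Definition exp_energy n x : R := expR (- 2 * sigma * energy n x).

Lemma is_derive_expR_affine (c a b s0 : R) :
  is_derive s0 1 (fun s => c * expR (a * s + b)) (c * a * expR (a * s0 + b)).
Proof.
have D1 : is_derive s0 1 (fun s : R => a * s + b) a.
  apply: is_derive_eq (is_deriveD (is_deriveZ a (is_derive_id s0 (1 : R)))
    (is_derive_cst b s0 1)) _.
  by rewrite /GRing.scale/= mulr1 addr0.
have D2 := @is_derive1_comp _ expR (fun s => a * s + b) _ _ _ (is_derive_expR _) D1.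
by apply: is_derive_eq (is_deriveZ c D2) _; rewrite /GRing.scale/=; ring.
Qed.

(** Stated for any [g] that agrees with a multiple of [exp_energy n] on summable tails, so that it
    applies again to first derivatives, whose form is known only there. *)
Lemma partial_exp_energy (c : R) (g : config R -> R) i n x : summable_tails x ->
  (forall y, summable_tails y -> g y = c * exp_energy n y) ->
  partial i g x = if n <= i then - 2 * sigma * (c * exp_energy n x) else 0.
Proof.
move=> xs gE; rewrite /partial; case: ifPn => ni.
  have -> : (fun s => g (update x i s)) = (fun s => c * expR ((- 2 * sigma) * s
      + (- 2 * sigma * (energy n x - x i)))).
    apply/funext => s; rewrite gE; last exact: update_tails.
    by rewrite /exp_energy energy_update// ni; congr (_ * expR _); ring.
  have D := is_derive_expR_affine c (- 2 * sigma) (- 2 * sigma * (energy n x - x i)) (x i).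
  rewrite derive1E derive_val -mulrDr addrCA subrr addr0 /exp_energy; ring.
have -> : (fun s => g (update x i s)) = cst (c * exp_energy n x).
  apply/funext => s; rewrite gE; last exact: update_tails.
  by rewrite /exp_energy energy_update// (negbTE ni) addr0.
by rewrite derive1_cst.
Qed.

(** E_n depends on x_i exactly when n <= i, so the two partial derivatives cancel unless n separates
    i from i + 1. *)
Lemma bond_derivative_exp_energy (c : R) (g : config R -> R) i n x : summable_tails x ->
  (forall y, summable_tails y -> g y = c * exp_energy n y) ->
  bond_derivative i g x = (if n == i + 1 then 2 * sigma * c else 0) * exp_energy n x.
Proof.
move=> xs gE; rewrite /bond_derivative !(partial_exp_energy c g _ n)//.
case: (ltgtP n (i + 1)) => h.
- by rewrite ifT ?ifF ?subrr ?mul0r//; lia.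
- by rewrite !ifF ?subrr ?mul0r//; lia.
- by rewrite ifF; [ring|lia].
Qed.

(** At n = i + 1 the products (1 - a)(b - 1) from the second and first order parts cancel, leaving
    2k (a + b - 2) u_n, where a u_n = u_(n-1) and b u_n = u_(n+1). *)
Lemma ABEP_bond_exp_energy i n x : summable_tails x ->
  ABEP_bond sigma k i (exp_energy n) x = if n == i + 1 then
    2 * k * (exp_energy (n + 1) x + exp_energy (n - 1) x - 2 * exp_energy n x) else 0.
Proof.
move=> xs; rewrite /ABEP_bond.
have b1 y : summable_tails y -> bond_derivative i (exp_energy n) y =
    (if n == i + 1 then 2 * sigma * 1 else 0) * exp_energy n y.
  by move=> ys; apply: bond_derivative_exp_energy => // z _; rewrite mul1r.
rewrite (bond_derivative_exp_energy _ _ i n x xs b1) b1//.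
case: eqP => [->|_]; last by rewrite !mul0r !mulr0 subrr.
rewrite addrK.
have -> : exp_energy i x = expR (- 2 * sigma * x i) * exp_energy (i + 1) x.
  by rewrite /exp_energy (energyS x i)// -expRD; congr expR; ring.
have -> : exp_energy (i + 1 + 1) x = expR (2 * sigma * x (i + 1)) * exp_energy (i + 1) x.
  by rewrite /exp_energy (energyS x (i + 1))// -expRD; congr expR; ring.
by field; rewrite gt_eqF.
Qed.

Lemma ABEP_generator_exp_energy n x : summable_tails x ->
  ABEP_generator sigma k (exp_energy n) x =
    2 * k * (exp_energy (n + 1) x + exp_energy (n - 1) x - 2 * exp_energy n x).
Proof.
move=> xs; rewrite /ABEP_generator -(@fsbig_widen _ _ _ _ [set n - 1] setT)//.
  by rewrite fsbig_set1 ABEP_bond_exp_energy// subrK eqxx.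
move=> i [_ /= /eqP ni]; rewrite ABEP_bond_exp_energy// ifF//.
by move: ni; lia.
Qed.

Lemma derive_exp_linear (a c : R) (v y : 'rV[R]_1) :
  derivable (fun v : 'rV[R]_1 => c * expR (a * v ord0 ord0)) y v /\
  'D_v (fun v : 'rV[R]_1 => c * expR (a * v ord0 ord0)) y =
    c * a * v ord0 ord0 * expR (a * y ord0 ord0).
Proof.
set phi := fun v : 'rV[R]_1 => _.
pose G (h : R) := c * expR (a * v ord0 ord0 * h + a * y ord0 ord0).
have [dG DG] := is_derive_expR_affine c (a * v ord0 ord0) (a * y ord0 ord0) 0.
(* The difference quotient along [v] is that of the one-variable function [G] at 0. *)
have E : (fun h => h^-1 *: ((phi \o shift y) (h *: v) - phi y)) =
    (fun h => h^-1 *: ((G \o shift 0) (h *: 1) - G 0)).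
  apply/funext => h; congr (_ *: (_ - _)); rewrite /phi /G /= ?mxE.
    by congr (_ * expR _); rewrite /GRing.scale/=; ring.
  by rewrite mulr0 add0r.
split; first by rewrite /derivable E.
by rewrite /derive E; apply: eq_trans DG _; rewrite mulr0 add0r mulrA.
Qed.

Lemma exp_energy_test n : ABEP_test (exp_energy n).
Proof.
(* A function of one energy, hence rows of length 1. The factor 1 puts [phi] in the shape c exp(a
   v), which directional derivatives preserve. *)
exists 0%N, n, (fun v => 1 * expR (- 2 * sigma * v ord0 ord0)); split; last first.
  by apply/funext => x; rewrite /exp_energy mul1r mxE addr0.
have DE c (v : 'rV[R]_1) : 'D_v (fun v : 'rV[R]_1 => c * expR (- 2 * sigma * v ord0 ord0)) =
    (fun y => (c * (- 2 * sigma) * v ord0 ord0) * expR (- 2 * sigma * y ord0 ord0)).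
  by apply/funext => y; have [_] := derive_exp_linear (- 2 * sigma) c v y.
have cE c : continuous (fun y : 'rV[R]_1 => c * expR (- 2 * sigma * y ord0 ord0)).
  move=> y; apply: (@continuousM R 'rV[R]_1 (cst c)); first exact: cst_continuous.
  apply: (@continuous_comp _ _ _ (fun y : 'rV[R]_1 => - 2 * sigma * y ord0 ord0) expR);
    last exact: continuous_expR.
  apply: (@continuousM R 'rV[R]_1 (cst (- 2 * sigma))); first exact: cst_continuous.
  exact: coord_continuous.
move=> v w; rewrite !DE; split => //.
- by move=> y; have [] := derive_exp_linear (- 2 * sigma) 1 v y.
- by move=> y; have [] := derive_exp_linear (- 2 * sigma) (1 * (- 2 * sigma) * v ord0 ord0) w y.
Qed.

Lemma exp_energy_itv n x : finite_energy x -> 0 <= exp_energy n x <= 1.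
Proof.
move=> xs; rewrite /exp_energy expR_ge0/= -[leRHS]expR0 ler_expR.
by rewrite -mulrA mulNr oppr_le0 !mulr_ge0 ?energy_ge0// ltW.
Qed.

Lemma measurable_config_coord d (V : measurableType d) (i : int) :
  measurable_fun setT (fun x : config V => x i).
Proof.
move=> _ B mB; rewrite setTI; apply: sub_sigma_algebra.
by exists i, B.
Qed.

Lemma measurable_exp_energy n d (Omega : measurableType d) (Y : Omega -> config R) :
  measurable_fun setT Y -> (forall w, finite_energy (Y w)) ->
  measurable_fun setT (fun w => exp_energy n (Y w)).
Proof.
move=> mY Ye; apply: (@measurableT_comp _ _ _ _ _ _ expR) => //.
apply: measurable_funM => //.
apply: (@measurable_fun_cvg _ _ _ _ (fun N w => series (fun m : nat => Y w (n + m%:Z)) N)) => //.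
  move=> N; apply: measurable_sum => m.
  exact: measurableT_comp (measurable_config_coord _ _ _) mY.
by move=> w _; apply: energy_cvg; exact: finite_energy_tails.
Qed.

End ABEP_exponential.

(** * One SIP particle *)

Definition one_particle (n : int) : config nat := fun i => (i == n : nat).

Lemma one_particle_inj : injective one_particle.
Proof.
move=> a b ab; have := congr1 (fun f => f a) ab.
by rewrite /one_particle eqxx; case: eqP.
Qed.

Lemma finite_one_particle n : finite_particles (one_particle n).
Proof.
apply: (@sub_finite_set _ _ [set n]); last exact: finite_set1.
by move=> i /=; rewrite /one_particle; have [->|] := eqVneq i n => //.
Qed.

Lemma move_one_particle a b : a != b -> move a b (one_particle a) = one_particle b.
Proof.
move=> ab; apply/funext => i; rewrite /move /update /one_particle.
have [_|ib] := eqVneq i b; first by rewrite eq_sym (negbTE ab).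
by have [_|] := eqVneq i a; rewrite ?eqxx.
Qed.

(** After the move [b] is occupied, so b = n and every other site is empty. An occupied [a] ensures
    that the truncated predecessor really removes a particle. *)
Lemma move_eq_one_particle (xi : config nat) a b n : a != b -> xi a != 0%N ->
  move a b xi = one_particle n -> xi = one_particle a.
Proof.
move=> ab xia e.
have E i : move a b xi i = (i == n : nat) by rewrite e.
have := E b; rewrite /move /update eqxx; case: eqP => // bn [xib].
apply/funext => i; rewrite /one_particle; case: eqP => [->|/eqP ia].
  have := E a; rewrite /move /update eqxx (negbTE ab) -bn (negbTE ab).
  by case: (xi a) xia => // -[].
have [->//|ib] := eqVneq i b.
by have := E i; rewrite /move /update (negbTE ib) (negbTE ia) -bn (negbTE ib).
Qed.

Section SIP_one_particle.
Context {R : realType} (k : R).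

Definition at_site (n : int) (xi : config nat) : R := \1_[set one_particle n] xi.

Lemma at_site_one n a : at_site n (one_particle a) = (a == n)%:R.
Proof.
rewrite /at_site indicE; congr (nat_of_bool _)%:R.
apply/idP/eqP => [/set_mem/one_particle_inj//|->].
exact/mem_set.
Qed.

Lemma at_site_eq0 n (xi : config nat) : xi <> one_particle n -> at_site n xi = 0.
Proof. by move=> h; rewrite /at_site indicE memNset. Qed.

(** On a one-particle configuration only the two bonds at the particle contribute, each with rate
    2k. On all others both sides vanish, because a jump conserves the number of particles. *)
Lemma SIP_generator_at_site n (xi : config nat) :
  SIP_generator k (at_site n) xi =
  2 * k * (at_site (n + 1) xi + at_site (n - 1) xi - 2 * at_site n xi).
Proof.
rewrite /SIP_generator.
have i1 (i : int) : i != i + 1 by lia.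
have i1' (i : int) : i + 1 != i by lia.
have [[a ->]|none] := pselect (exists a, xi = one_particle a).
  rewrite (fsbigE [:: a; a - 1])//=.
  - rewrite !big_cons big_nil !in_setT /= subrK /one_particle !eqxx.
    rewrite -/(one_particle a) (negbTE (i1' a)) move_one_particle//.
    rewrite (negbTE (_ : a - 1 != a)); last by lia.
    rewrite (@move_one_particle a (a - 1)); last by lia.
    rewrite !at_site_one !mul0r !add0r !addr0 !mul1r.
    rewrite (_ : (a + 1 == n) = (a == n - 1)); last by lia.
    rewrite (_ : (a - 1 == n) = (a == n + 1)); last by lia.
    by ring.
  - by rewrite inE andbT; lia.
  - move=> i _; rewrite !inE negb_or => /andP[ia ia1].
    have ia' : i + 1 != a by move: ia1; lia.
    by rewrite /one_particle (negbTE ia) (negbTE ia') !mul0r addr0.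
have z m : at_site m xi = 0.
  by apply: at_site_eq0 => e; apply: none; exists m.
rewrite !z fsbig1; first by rewrite mulr0 subr0 addr0 mulr0.
have H a b : a != b -> (xi a)%:R * (at_site n (move a b xi) - 0) = 0.
  move=> ab; have [->|xia] := eqVneq (xi a) 0%N; first by rewrite mul0r.
  rewrite at_site_eq0 ?subr0 ?mulr0// => e; apply: none; exists a.
  exact: move_eq_one_particle e.
by move=> i _; rewrite mulrAC H// mul0r mulrAC H// mul0r addr0.
Qed.

Lemma measurable_one_particle n : measurable [set one_particle n].
Proof.
rewrite (_ : [set _] = \bigcap_(m in [set: nat])
  ((fun xi : config nat => xi m%:Z) @^-1` [set one_particle n m%:Z] `&`
   (fun xi : config nat => xi (- m%:Z)) @^-1` [set one_particle n (- m%:Z)])).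
  apply: bigcapT_measurable => m; apply: measurableI;
    rewrite -[X in measurable X]setTI; exact: measurable_config_coord.
apply/seteqP; split => [_ -> //|xi H].
by apply/funext => i; have [] := H `|i|%N Logic.I; case: i.
Qed.

Lemma measurable_at_site n d (Omega : measurableType d) (Y : Omega -> config nat) :
  measurable_fun setT Y -> measurable_fun setT (fun w => at_site n (Y w)).
Proof.
move=> mY; apply: (@measurableT_comp _ _ _ _ _ _ (at_site n)) => //.
by apply: measurable_indic; exact: measurable_one_particle.
Qed.

Lemma SIP_one_particle_law d (Omega : measurableType d)
    (P : config nat -> probability Omega R) (X : R -> Omega -> config nat) a n (t : R) :
  0 < k -> is_SIP k P X -> 0 <= t ->
  (P (one_particle a) (X t @^-1` [set one_particle n]) =
   (expR (- (2 * (2 * k) * t)) * besselI `|n - a|%N (2 * (2 * k) * t))%:E)%E.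
Proof.
move=> k0 [mX _ gX] t0.
have mXt := mp_measurable mX t0.
have c0 : 0 <= 2 * k by rewrite mulr_ge0// ltW.
have mf m (s : R) : 0 <= s -> measurable_fun setT (fun w => at_site m (X s w)).
  by move=> s0; exact: (measurable_at_site m _ _ (X s) (mp_measurable mX s0)).
have f01 m (xi : config nat) : finite_particles xi -> 0 <= at_site m xi <= 1.
  by move=> _; rewrite /at_site indicE; case: (_ \in _); rewrite ?lexx ?ler01.
have Lf m (xi : config nat) : finite_particles xi -> _ :=
  fun _ => SIP_generator_at_site m xi.
have := @expectation_lattice_bessel R _ _ _ _ _ _ _ P X (2 * k) at_site mX gX c0
  (fun=> I) mf f01 Lf n (one_particle a) t (finite_one_particle a) t0.
rewrite (_ : (fun w => at_site n (X t w)) = \1_(X t @^-1` [set one_particle n])); last first.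
  by apply/funext => w; rewrite /at_site !indicE.
rewrite unlock integral_indic// ?setIT; last first.
  by rewrite -[X in measurable X]setTI; apply: mXt => //; exact: measurable_one_particle.
move=> ->; rewrite EFinM; congr (_ * _)%E.
have b0 m : (0 <= (at_site m (one_particle a) *
    besselI `|m - n|%N (2 * (2 * k) * t))%:E)%E.
  have /andP[? _] := f01 m _ (finite_one_particle a).
  rewrite lee_fin; apply: mulr_ge0 => //; apply: besselI_ge0.
  by apply: mulr_ge0 => //; apply: mulr_ge0.
rewrite (esumID [set a])// setTI esum_set1// esum1 ?adde0; last first.
  by move=> m [_ /= /eqP ma]; rewrite at_site_one eq_sym (negbTE ma) mul0r.
by rewrite at_site_one eqxx mul1r distnC.
Qed.

End SIP_one_particle.

(** * The duality function *)

Section duality_function.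
Context {R : realType} (sigma k : R).
Hypothesis sigma0 : 0 < sigma.
Hypothesis k0 : 0 < k.
Implicit Types (x : config R) (xi : config nat).

Lemma energy_nonincreasing x n : finite_energy x -> energy (n + 1) x <= energy n x.
Proof.
move=> xs; rewrite [leRHS]energyS ?lerDr; last exact: finite_energy_tails.
by case: xs.
Qed.

Let factor_ge0 x xi i : finite_energy x ->
  0 <= Gamma (2 * k) / Gamma (2 * k + (xi i)%:R) *
     ((expR (- 2 * sigma * energy (i + 1) x) - expR (- 2 * sigma * energy i x))
        / (2 * sigma)) ^+ xi i.
Proof.
move=> xs; have k20 : 0 < 2 * k by rewrite mulr_gt0.
apply: mulr_ge0.
  by apply: divr_ge0; apply: ltW; apply: Gamma_gt0 => //; rewrite ltr_wpDr.
apply: exprn_ge0; apply: divr_ge0; last by rewrite mulr_ge0// ltW.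
rewrite subr_ge0 ler_expR -!mulrA !mulNr lerN2 ler_wpM2l// ler_wpM2l ?(ltW sigma0)//.
exact: energy_nonincreasing.
Qed.

Lemma dual_D_ge0 x xi : finite_energy x -> 0 <= dual_D sigma k x xi.
Proof. by move=> xs; apply: prodr_ge0 => i _; exact: factor_ge0. Qed.

(** An empty site contributes Gamma(2k) / Gamma(2k) = 1, which uses the positivity of Gamma. *)
Lemma dual_D_one x n :
  dual_D sigma k x (one_particle n) = Gamma (2 * k) / Gamma (2 * k + 1) / (2 * sigma) *
    (expR (- 2 * sigma * energy (n + 1) x) - expR (- 2 * sigma * energy n x)).
Proof.
rewrite /dual_D -(@fsbig_widen _ _ _ _ [set n] setT)//.
  by rewrite fsbig_set1 /one_particle eqxx expr1; ring.
move=> i [_ /= /eqP ni]; rewrite /one_particle (negbTE ni) expr0 addr0 mulr1 divff//.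
by rewrite gt_eqF// Gamma_gt0// mulr_gt0.
Qed.

Lemma prefactor_one (g : int -> R) n :
  \big[*%R/1%R]_(i \in [set: int])
    expR (2 * sigma * (one_particle n i)%:R * g i) = expR (2 * sigma * g n).
Proof.
rewrite -(@fsbig_widen _ _ _ _ [set n] setT)//.
  by rewrite fsbig_set1 /one_particle eqxx mulr1.
by move=> i [_ /= /eqP ni]; rewrite /one_particle (negbTE ni) mulr0 mul0r expR0.
Qed.

(** The events [A n] are disjoint, [dual_D] is constant on each, and its nonnegativity allows the
    rest of the space to be discarded. A finite list [r] suffices for bounding partial sums. *)
Lemma expectation_dual_D_ge d (Omega : measurableType d)
    (P : config nat -> probability Omega R) (X : R -> Omega -> config nat)
    x a (t : R) (r : seq int) :
  is_SIP k P X -> 0 <= t -> finite_energy x -> uniq r ->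
  ((\sum_(n <- r) dual_D sigma k x (one_particle n) *
     (expR (- (4 * k * t)) * besselI `|n - a|%N (4 * k * t)))%:E <=
   'E_(P (one_particle a))[fun w => dual_D sigma k x (X t w)])%E.
Proof.
move=> SIPX t0 xs r_uniq; have [mX _ _] := SIPX.
have mXt := mp_measurable mX t0.
pose A n := X t @^-1` [set one_particle n].
have mA n : measurable (A n).
  by rewrite -[X in measurable X]setTI; apply: mXt => //; exact: measurable_one_particle.
have D0 n : 0 <= dual_D sigma k x (one_particle n) by exact: dual_D_ge0.
rewrite expectation.unlock -sumEFin.
apply: (@le_trans _ _ (\int[P (one_particle a)]_w
    \sum_(n <- r) (dual_D sigma k x (one_particle n) * \1_(A n) w)%:E)%E).
  rewrite ge0_integral_sum//; last 2 first.
  - move=> n; apply/measurable_EFinP; apply: measurable_funM => //.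
  - by move=> n w _; rewrite lee_fin mulr_ge0// indicE.
  apply: lee_sum => n _.
  under eq_integral do rewrite EFinM.
  rewrite ge0_integralZl_EFin//; last first.
    by apply/measurable_EFinP.
  rewrite integral_indic// setIT.
  have := SIP_one_particle_law k _ _ P X a n t k0 SIPX t0.
  rewrite (_ : 2 * (2 * k) = 4 * k); last by ring.
  by move=> law; rewrite EFinM; apply: lee_wpmul2l; rewrite ?lee_fin// -law.
apply: le_ge0_integral => // w _.
- by apply: sume_ge0 => n _; rewrite lee_fin mulr_ge0// indicE.
- by rewrite lee_fin dual_D_ge0.
rewrite sumEFin lee_fin.
have [[b Xb]|none] := pselect (exists b, X t w = one_particle b); last first.
  rewrite big1 ?dual_D_ge0// => n _; rewrite indicE memNset ?mulr0// => e.
  by apply: none; exists n.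
rewrite Xb.
have E n : \1_(A n) w = (b == n)%:R :> R.
  rewrite indicE; congr (nat_of_bool _)%:R; apply/idP/eqP.
    by move=> /set_mem; rewrite /A/= Xb => /one_particle_inj.
  by move=> <-; exact/mem_set.
have [br|br] := boolP (b \in r); last first.
  rewrite big_seq big1 ?D0// => n nr; rewrite E; case: eqP => [bn|]; last by rewrite mulr0.
  by move: br; rewrite bn nr.
rewrite (bigD1_seq b)//= E eqxx mulr1 big1 ?addr0// => n nb.
by rewrite E eq_sym (negbTE nb) mulr0.
Qed.

End duality_function.

(** * Summability *)

Section sums.
Context {R : realType}.

(** Termwise comparison: r! (l + m)! <= (l + m + r)!, the quotient being a binomial coefficient. *)
Lemma besselI_addn (m r : nat) (z : R) : 0 <= z ->
  besselI (m + r) z <= besselI m z * exp_coeff (z / 2) r.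
Proof.
move=> z0; have z2 : 0 <= z / 2 by rewrite divr_ge0.
rewrite -lee_fin mulrC EFinM !besselI_esum// -esumZl; last 2 first.
- exact: exp_coeff_ge0.
- by move=> l _; exact: besselI_term_ge0.
apply: le_esum => l _; rewrite lee_fin.
rewrite [leRHS](_ : _ = (z / 2) ^+ (2 * l + (m + r)) / (r`! * (l`! * (l + m)`!))%N%:R); last first.
  by rewrite /exp_coeff/= addnA (exprD _ _ r) !natrM !invfM; ring.
rewrite ler_wpM2l ?exprn_ge0// lef_pV2 ?posrE ?ltr0n ?muln_gt0 ?fact_gt0// ler_nat.
rewrite mulnCA leq_mul2l; apply/orP; right.
rewrite addnA -(@bin_fact (l + m + r) r) ?leq_addl// addnK.
by rewrite leq_pmull// bin_gt0 leq_addl.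
Qed.

(* Summation by parts, with the tails of [a] controlled by [a] itself. *)
Lemma esum_partial_sums_lty (a c D : nat -> R) :
  (forall m, 0 <= a m) -> (forall m, 0 <= c m) -> (forall m, 0 <= D m) ->
  (forall m r, a (m + r)%N <= a m * c r) ->
  (\esum_(m in [set: nat]) (c m)%:E < +oo)%E ->
  (\esum_(m in [set: nat]) (a m * D m)%:E < +oo)%E ->
  (\esum_(m in [set: nat]) (a m * \sum_(j < m.+1) D j)%:E < +oo)%E.
Proof.
move=> a0 c0 D0 ac coo aDoo.
have aD0 m : 0 <= a m * D m by rewrite mulr_ge0.
pose w j l : \bar R := (a j * D j * c l)%:E.
have w0 j l : (0 <= w j l)%E by rewrite lee_fin mulr_ge0.
(* Writing m = j + (m - j) gives a_m D_j <= a_j D_j c_(m-j), a convolution whose total is the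
   product of the two finite sums. *)
apply: (@le_lt_trans _ _ (\esum_(m in [set: nat]) \sum_(j < m.+1) w j (m - j)%N)%E).
  apply: le_esum => m _; rewrite sumEFin lee_fin mulr_sumr; apply: ler_sum => -[j jm] _ /=.
  rewrite mulrAC ler_wpM2r// -{1}(@subnKC j m)//.
rewrite esum_antidiagonal//.
rewrite (_ : [set: nat * nat] = [set: nat] `*`` (fun=> [set: nat])); last by apply/seteqP; split.
rewrite -(esum_esum (a := w)); last by [].
rewrite (eq_esum (b := fun j => (a j * D j)%:E * \esum_(l in [set: nat]) (c l)%:E)%E); last first.
  by move=> j _; rewrite /w esumZl.
have cfin : (\esum_(l in [set: nat]) (c l)%:E)%E \is a fin_num.
  by rewrite ge0_fin_numE//; apply: esum_ge0 => l _; rewrite lee_fin.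
have s0 : 0 <= fine (\esum_(l in [set: nat]) (c l)%:E)%E.
  by apply: fine_ge0; apply: esum_ge0 => l _; rewrite lee_fin.
rewrite -(fineK cfin).
under eq_esum => j _ do rewrite -EFinM mulrC.
by rewrite esumZl// lte_mul_pinfty// lee_fin.
Qed.

Lemma esum_int_lty (a : int -> R) (i : int) : (forall n, 0 <= a n) ->
  (\esum_(m in [set: nat]) (a (i + m%:Z))%:E < +oo)%E ->
  (\esum_(m in [set: nat]) (a (i - m%:Z))%:E < +oo)%E ->
  (\esum_(n in [set: int]) (a n)%:E < +oo)%E.
Proof.
move=> a0 ap am.
have a0' n : (0 <= (a n)%:E)%E by rewrite lee_fin.
rewrite (esumID (range (fun m : nat => i + m%:Z)))// setTI; apply: lte_add_pinfty.
  by rewrite (esum_image _ (fun m : nat => i + m%:Z) (fun n => (a n)%:E))// => m m' _ _ /addrI[].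
apply: le_lt_trans am.
rewrite -(esum_image _ (fun m : nat => i - m%:Z) (fun n => (a n)%:E)); last first.
  by move=> m m' _ _ /addrI/oppr_inj[].
rewrite esum_mkcond [leRHS]esum_mkcond; apply: le_esum => n _.
case: ifPn => [|_]; last by case: ifP.
rewrite inE => -[_ nr]; rewrite ifT// inE.
exists `|i - n|%N => //; case: (leP i n) => h; last by lia.
by exfalso; apply: nr; exists `|n - i|%N => //; lia.
Qed.

(** Dominated convergence for entries that stabilise from index [h n] on. A finite set [X] carries
    all but [e] of the sum of [b]; once [L] exceeds [h] on [X], the sums agree on [X], and their
    tails both lie in [0, e]. *)
Lemma dominated_cvg_esum (T : choiceType) (a : nat -> T -> R) (a' b : T -> R)
    (h : T -> nat) :
  (forall L n, 0 <= a L n <= b n) -> (forall n L, (h n <= L)%N -> a L n = a' n) ->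
  (\esum_(n in [set: T]) (b n)%:E < +oo)%E ->
  (\esum_(n in [set: T]) (a' n)%:E < +oo)%E /\
  ((\esum_(n in [set: T]) (a L n)%:E) @[L --> \oo] -->
    \esum_(n in [set: T]) (a' n)%:E)%E.
Proof.
move=> ab aE boo.
have a'b n : 0 <= a' n <= b n by rewrite -(aE n (h n)).
have b0 n : 0 <= b n by case/andP: (a'b n) => /le_trans; apply.
have fin (c : T -> R) (A : set T) : (forall n, 0 <= c n <= b n) -> (\esum_(n in A) (c n)%:E)%E \is a fin_num.
  move=> cb; rewrite ge0_fin_numE; last first.
    by apply: esum_ge0 => n _; rewrite lee_fin; case/andP: (cb n).
  apply: le_lt_trans boo; rewrite [leRHS](esumID A) ?setTI; last by move=> n _; rewrite lee_fin.
  apply: (@le_trans _ _ (\esum_(n in A) (b n)%:E)%E).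
    by apply: le_esum => n _; rewrite lee_fin; case/andP: (cb n).
  by rewrite leeDl//; apply: esum_ge0 => n _; rewrite lee_fin.
have bb n : 0 <= b n <= b n by rewrite b0 lexx.
split; first by have := fin a' setT a'b; rewrite fin_numElt => /andP[].
rewrite -(fineK (fin a' setT a'b)); apply: cvg_EFin.
  by apply: nearW => L; exact: fin.
apply/cvgrPdist_le => e e0.
have [X [finX _] Xb] : exists2 X : set T, fsets setT X &
    (\esum_(n in [set: T]) (b n)%:E - e%:E < \sum_(n \in X) (b n)%:E)%E.
  have := ub_ereal_sup_adherent e0 (fin b setT bb).
  by move=> [_ [X XT <-] ?]; exists X.
have tail (c : T -> R) : (forall n, 0 <= c n <= b n) ->
    (0 <= \esum_(n in ~` X) (c n)%:E <= e%:E)%E.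
  move=> cb; apply/andP; split.
    by apply: esum_ge0 => n _; rewrite lee_fin; case/andP: (cb n).
  apply: (@le_trans _ _ (\esum_(n in ~` X) (b n)%:E)%E).
    by apply: le_esum => n _; rewrite lee_fin; case/andP: (cb n).
  move: Xb; rewrite -esum_fset//; last by move=> n _; rewrite lee_fin.
  rewrite (esumID X) ?setTI; last by move=> n _; rewrite lee_fin.
  rewrite -(fineK (fin b X bb)) -(fineK (fin b (~` X) bb)).
  by rewrite -?EFinD -?EFinB lte_fin lee_fin => ?; lra.
pose M := (\max_(n <- fset_set X) h n)%N.
near=> L.
have ML : (M <= L)%N by near: L; exact: nbhs_infty_ge.
have hL n : X n -> (h n <= L)%N.
  move=> Xn; apply: leq_trans ML.
  by apply: (@leq_bigmax_seq _ _ xpredT h) => //; rewrite in_fset_set// mem_set.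
have split_sum (c : T -> R) : (forall n, 0 <= c n <= b n) ->
    fine (\esum_(n in [set: T]) (c n)%:E)%E =
    fine (\esum_(n in X) (c n)%:E)%E + fine (\esum_(n in ~` X) (c n)%:E)%E.
  move=> cb; rewrite -fineD; [|exact: fin|exact: fin].
  rewrite (esumID X) ?setTI//.
  by move=> n _; rewrite lee_fin; case/andP: (cb n).
rewrite /= !split_sum//.
rewrite (eq_esum (a := fun n => (a L n)%:E) (b := fun n => (a' n)%:E)); last first.
  by move=> n Xn; rewrite aE//; exact: hL.
have := tail _ a'b; have := tail _ (ab L).
rewrite -(fineK (fin _ (~` X) a'b)) -(fineK (fin _ (~` X) (ab L))) !lee_fin.
move=> /andP[? ?] /andP[? ?]; rewrite ler_norml; apply/andP; split; lra.
Unshelve. all: by end_near. Qed.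

End sums.

(** * The infinite-volume limit *)

Section current.
Context {R : realType} (sigma k : R).
Hypothesis sigma0 : 0 < sigma.
Hypothesis k0 : 0 < k.
Implicit Types (x : config R) (i n : int).

Lemma truncate_ge0 x (L : nat) i : (forall j, 0 <= x j) -> 0 <= truncate L x i.
Proof. by move=> x0; rewrite /truncate; case: ifP. Qed.

Lemma truncate_le x (L : nat) i : (forall j, 0 <= x j) -> truncate L x i <= x i.
Proof. by move=> x0; rewrite /truncate; case: ifP. Qed.

Lemma energy_diff_truncate n i x (L : nat) : (`|n| + `|i| <= L)%N ->
  energy_diff n i (truncate L x) = energy_diff n i x.
Proof.
move=> niL; rewrite /energy_diff; case: ifPn => ni; [|congr (- _)];
  apply: eq_big_nat => m mi; rewrite /truncate ifT//; lia.
Qed.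

Let W x i n := expR (- 2 * sigma * energy_diff n i x).

Let W_truncate n i x (L : nat) : (`|n| + `|i| <= L)%N -> W (truncate L x) i n = W x i n.
Proof. by move=> h; rewrite /W energy_diff_truncate. Qed.

Let sigma_le (a b : R) : a <= b -> expR (- 2 * sigma * b) <= expR (- 2 * sigma * a).
Proof.
by move=> ab; rewrite ler_expR -!mulrA !mulNr lerN2 ler_wpM2l// ler_wpM2l// ltW.
Qed.

Let W_finite x i n : finite_energy x ->
  W x i n = expR (2 * sigma * energy i x) * exp_energy sigma n x.
Proof.
move=> xs; rewrite /W energy_diffE; last exact: finite_energy_tails.
by rewrite /exp_energy -expRD; congr expR; ring.
Qed.

Let W_le1 x i n : (forall j, 0 <= x j) -> n <= i -> W x i n <= 1.
Proof.
move=> x0 ni; rewrite -[leRHS]expR0 -(mulr0 (- 2 * sigma)); apply: sigma_le.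
by rewrite /energy_diff ni sumr_ge0.
Qed.

Let W_leS x i n : (forall j, 0 <= x j) -> W x i n <= W x i (n + 1).
Proof.
(* A truncation large enough to leave both weights unchanged makes the energies themselves
   available. *)
move=> x0; pose L := (`|n| + `|i| + 1)%N.
rewrite -(W_truncate n i x L) -1?(W_truncate (n + 1) i x L); [|lia|lia].
have xs := truncate_finite_energy L x x0.
rewrite /W !energy_diffE; try exact: finite_energy_tails.
by apply: sigma_le; rewrite lerD2r energy_nonincreasing.
Qed.

(** To the right of [i] truncation lowers the weight; to the left it may raise it, but never above
    1. *)
Let W_truncate_le x i n (L : nat) : (forall j, 0 <= x j) ->
  W (truncate L x) i n <= W x i n + 1.
Proof.
move=> x0; have [ni|ni] := leP n i.
  apply: le_trans (W_le1 _ i n _ ni) _; first by move=> j; exact: truncate_ge0.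
  by rewrite lerDr expR_ge0.
rewrite ler_wpDr//; apply: sigma_le; rewrite /energy_diff (lt_geF ni) lerN2.
by apply: ler_sum => m _; exact: truncate_le.
Qed.

(** * Summability and convergence for a good configuration *)

Section good.
Variables (dS : measure_display) (Omega : measurableType dS).
Variables (P : config nat -> probability Omega R) (X : R -> Omega -> config nat).
Hypothesis SIP_X : is_SIP k P X.
Variable x : config R.
Hypothesis good_x : good_configuration sigma k P X x.
Variables (i : int) (t : R).
Hypothesis t0 : 0 <= t.
Let x0 : forall j, 0 <= x j. Proof. by case: good_x. Qed.
Let z := 4 * k * t.
Let z0 : 0 <= z. Proof. by rewrite /z !mulr_ge0// ltW. Qed.

(** The particle starts at i - 1 because the prefactor of goodness is then exp(2 sigma E_i), which
    turns differences of exp(-2 sigma E_n) into differences of [W]. The bound is the limit given by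
    goodness divided by [C], which collects the constants of the duality function and of the
    particle law. *)
Let increment_bound : exists K : R, forall N : nat,
  \sum_(m < N) besselI m z * (W x i (i + m%:Z) - W x i (i - 1 + m%:Z)) <= K.
Proof.
have alg (c q b E u v : R) : c * q * (b * (E * u - E * v)) = E * (c * (u - v) * (q * b)).
  by ring.
have [_ /(_ t (one_particle (i - 1)) t0 (finite_one_particle _))[l ul]] := good_x.
pose C := Gamma (2 * k) / Gamma (2 * k + 1) / (2 * sigma) * expR (- z).
have C0 : 0 < C.
  apply: mulr_gt0; last exact: expR_gt0.
  apply: divr_gt0; last exact: mulr_gt0.
  have k20 : 0 < 2 * k by exact: mulr_gt0.
  by apply: divr_gt0; apply: Gamma_gt0 => //; exact: addr_gt0.
exists (C^-1 * l) => N; rewrite mulrC ler_pdivlMr// mulrC -lee_fin.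
apply: cvge_to_ge ul _.
near=> L.
(* Beyond this size truncation changes none of the weights at i + m and i - 1 + m with m < N. *)
have hL : (`|i| + `|i| + N + 2 <= L)%N by near: L; exact: nbhs_infty_ge.
have xs := truncate_finite_energy L x x0.
rewrite prefactor_one subrK.
pose r := [seq i - 1 + m%:Z | m <- index_iota 0 N].
have r_uniq : uniq r.
  by rewrite map_inj_uniq ?iota_uniq// => m m' /addrI[].
have := expectation_dual_D_ge sigma k sigma0 k0 _ _ P X (truncate L x) (i - 1) t r SIP_X t0 xs r_uniq.
have e0 : (0 <= (expR (2 * sigma * energy i (truncate L x)))%:E)%E by rewrite lee_fin expR_ge0.
move=> /(lee_wpmul2l e0); apply: le_trans; rewrite -EFinM lee_fin.
rewrite /r big_map big_mkord !mulr_sumr; apply: ler_sum => -[m mN] _ /=.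
rewrite le_eqVlt; apply/orP; left; apply/eqP.
rewrite dual_D_one// -/(exp_energy _ _ _) -/(exp_energy _ _ _).
rewrite -(W_truncate (i + m%:Z) i x L); last by lia.
rewrite -(W_truncate (i - 1 + m%:Z) i x L); last by lia.
rewrite !W_finite// (_ : i - 1 + m%:Z + 1 = i + m%:Z); last by lia.
rewrite (_ : absz (i - 1 + m%:Z - (i - 1))%R = m); last by lia.
exact: alg.
Unshelve. all: by end_near. Qed.

Let bessel_lty : (\esum_(m in [set: nat]) (besselI m z)%:E < +oo)%E.
Proof.
apply: (@le_lt_trans _ _ (\esum_(m in [set: nat]) (besselI 0 z * exp_coeff (z / 2) m)%:E)%E).
  by apply: le_esum => m _; rewrite lee_fin -{1}(add0n m) besselI_addn.
have e0 m : 0 <= exp_coeff (z / 2) m by rewrite exp_coeff_ge0// divr_ge0.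
rewrite esumZl ?besselI_ge0//.
rewrite (esum_series _ (expR (z / 2)))//; first by rewrite -EFinM ltry.
exact: is_cvg_series_exp_coeff.
Qed.

(** The increments telescope to W_(i+m) - W_(i-1) with W_(i-1) <= 1, so the sum is at most the
    partial-sum series plus the sum of the Bessel functions. *)
Let right_lty : (\esum_(m in [set: nat]) (W x i (i + m%:Z) * besselI m z)%:E < +oo)%E.
Proof.
pose D (m : nat) := W x i (i + m%:Z) - W x i (i - 1 + m%:Z).
have D0 m : 0 <= D m.
  by rewrite subr_ge0 (_ : i + m%:Z = i - 1 + m%:Z + 1); [exact: W_leS|lia].
have DE m : \sum_(j < m.+1) D j = W x i (i + m%:Z) - W x i (i - 1).
  elim: m => [|m IH]; first by rewrite big_ord1 /D !addr0.
  rewrite big_ord_recr/= IH /D (_ : i - 1 + m.+1%:Z = i + m%:Z); last by lia.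
  by ring.
apply: (@le_lt_trans _ _ (\esum_(m in [set: nat])
    ((besselI m z * \sum_(j < m.+1) D j)%:E + (besselI m z)%:E))%E).
  apply: le_esum => m _; rewrite -EFinD lee_fin DE.
  have := W_le1 x i (i - 1) x0; rewrite gerBl ler01 => /(_ isT) W1.
  by have := besselI_ge0 m z z0; nra.
rewrite esumD; last 2 first.
- by move=> m _; rewrite lee_fin mulr_ge0 ?besselI_ge0 ?sumr_ge0.
- by move=> m _; rewrite lee_fin besselI_ge0.
apply: lte_add_pinfty => //.
apply: (esum_partial_sums_lty _ (exp_coeff (z / 2))) => //.
- by move=> m; exact: besselI_ge0.
- by move=> m; rewrite exp_coeff_ge0// divr_ge0.
- by move=> m r; exact: besselI_addn.
- rewrite (esum_series _ (expR (z / 2))) ?ltry//; last exact: is_cvg_series_exp_coeff.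
  by move=> m; rewrite exp_coeff_ge0// divr_ge0.
have [K hK] := increment_bound.
apply: (@le_lt_trans _ _ K%:E); last exact: ltry.
rewrite -nneseries_esumT; last by move=> m; rewrite lee_fin mulr_ge0 ?besselI_ge0.
apply: lime_le.
  by apply: is_cvg_nneseries => m _ _; rewrite lee_fin mulr_ge0 ?besselI_ge0.
by apply: nearW => N; rewrite sumEFin lee_fin big_mkord; exact: hK.
Qed.

Let left_lty : (\esum_(m in [set: nat]) (W x i (i - m%:Z) * besselI m z)%:E < +oo)%E.
Proof.
apply: le_lt_trans bessel_lty; apply: le_esum => m _.
by rewrite lee_fin ler_piMl ?besselI_ge0// W_le1// gerBl.
Qed.

Lemma truncated_bessel_sum_cvg :
  (\esum_(n in [set: int])
     (expR (- 2 * sigma * energy_diff n i x) * besselI `|n - i|%N z)%:E < +oo)%E /\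
  ((\esum_(n in [set: int])
     (expR (- 2 * sigma * energy_diff n i (truncate L x)) * besselI `|n - i|%N z)%:E)
    @[L --> \oo] -->
   \esum_(n in [set: int])
     (expR (- 2 * sigma * energy_diff n i x) * besselI `|n - i|%N z)%:E)%E.
Proof.
have I0 (m : nat) : 0 <= besselI m z by exact: besselI_ge0.
apply: (dominated_cvg_esum _ (fun L (n : int) => W (truncate L x) i n * besselI (absz (n - i)%R) z)
  (fun n : int => W x i n * besselI (absz (n - i)%R) z)
  (fun n : int => (W x i n + 1) * besselI (absz (n - i)%R) z) (fun n : int => absz n + absz i)%N).
- move=> L n; rewrite mulr_ge0 ?expR_ge0//= ler_wpM2r//; exact: W_truncate_le.
- by move=> n L h; rewrite W_truncate.
have W0 n : 0 <= W x i n by exact: expR_ge0.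
apply: (esum_int_lty _ i) => [n||]; first by rewrite mulr_ge0 ?addr_ge0.
- rewrite (eq_esum (b := fun m => ((W x i (i + m%:Z) * besselI m z)%:E + (besselI m z)%:E)%E)).
    rewrite esumD; [|by move=> m _; rewrite lee_fin mulr_ge0|by move=> m _; rewrite lee_fin].
    exact: lte_add_pinfty.
  by move=> m _; rewrite (_ : absz (i + m%:Z - i)%R = m) ?mulrDl ?mul1r ?EFinD//; lia.
- rewrite (eq_esum (b := fun m => ((W x i (i - m%:Z) * besselI m z)%:E + (besselI m z)%:E)%E)).
    rewrite esumD; [|by move=> m _; rewrite lee_fin mulr_ge0|by move=> m _; rewrite lee_fin].
    exact: lte_add_pinfty.
  by move=> m _; rewrite (_ : absz (i - m%:Z - i)%R = m) ?mulrDl ?mul1r ?EFinD//; lia.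
Qed.

End good.

(** The observable is exp(2 sigma E_i(x)) times u_i at time t. Moving this constant inside the
    Bessel sum for u_i turns each u_n(x) into exp(-2 sigma (E_n - E_i)). *)
Lemma ABEP_current_moment d (Omega : measurableType d)
    (P : config R -> probability Omega R) (X : R -> Omega -> config R)
    x i (t : R) : is_ABEP sigma k P X -> finite_energy x -> 0 <= t ->
  ('E_(P x)[fun w => expR (- 2 * sigma * (energy i (X t w) - energy i x))] =
   (expR (- 4 * k * t))%:E * \esum_(n in [set: int])
     (expR (- 2 * sigma * energy_diff n i x) * besselI `|n - i|%N (4 * k * t))%:E)%E.
Proof.
move=> [mX _ gX] xs t0; have k2 : 0 <= 2 * k by rewrite mulr_ge0// ltW.
have mf n (s : R) : 0 <= s -> measurable_fun setT (fun w => exp_energy sigma n (X s w)).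
  move=> s0; apply: measurable_exp_energy; first exact: (mp_measurable mX).
  by move=> w; exact: (mp_state mX).
have Lf n (y : config R) : finite_energy y -> _ :=
  fun ys => ABEP_generator_exp_energy sigma k sigma0 n y (finite_energy_tails y ys).
have := @expectation_lattice_bessel R _ _ _ _ _ _ _ P X (2 * k) (exp_energy sigma)
  mX gX k2 (exp_energy_test sigma) mf (exp_energy_itv sigma sigma0) Lf i x t xs t0.
have -> : 2 * (2 * k) * t = 4 * k * t by ring.
have -> : - (4 * k * t) = - 4 * k * t by ring.
rewrite !expectation.unlock => EX.
rewrite (eq_integral (fun w => ((expR (2 * sigma * energy i x))%:E *
    (exp_energy sigma i (X t w))%:E)%E)); last first.
  by move=> w _; rewrite -EFinM -expRD; congr (expR _)%:E; ring.
have f0 w : [set: Omega] w -> (0 <= (exp_energy sigma i (X t w))%:E)%E.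
  by move=> _; rewrite lee_fin expR_ge0.
have mfi : measurable_fun setT (fun w => (exp_energy sigma i (X t w))%:E).
  by apply/measurable_EFinP; exact: mf.
rewrite (ge0_integralZl_EFin _ measurableT f0 mfi (expR_ge0 _)).
rewrite EX muleCA; congr (_ * _)%E; rewrite -esumZl ?expR_ge0//; last first.
  move=> n _; rewrite mulr_ge0 ?expR_ge0// besselI_ge0//.
  by rewrite !mulr_ge0// ltW.
by apply: eq_esum => n _; rewrite mulrA -W_finite.
Qed.

End current.

Theorem proposition6p5 (R : realType) (sigma k : R)
  (sigma_gt0 : 0 < sigma) (k_gt0 : 0 < k)
  (dA : measure_display) (OmegaA : measurableType dA)
  (PA : config R -> probability OmegaA R) (X : R -> OmegaA -> config R)
  (ABEP_X : is_ABEP sigma k PA X)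
  (dS : measure_display) (OmegaS : measurableType dS)
  (PS : config nat -> probability OmegaS R) (Xi : R -> OmegaS -> config nat)
  (SIP_Xi : is_SIP k PS Xi)
  (x : config R) (good_x : good_configuration sigma k PS Xi x)
  (i : int) (t : R) (t_ge0 : 0 <= t) :
  let bessel_sum : \bar R :=
    (\esum_(n in [set: int])
       (expR (- 2 * sigma * energy_diff n i x) * besselI `|n - i|%N (4 * k * t))%:E)%E in
  (bessel_sum < +oo)%E /\
  ('E_(PA (truncate L x))[fun w =>
      expR (- 2 * sigma * (energy i (X t w) - energy i (truncate L x)))])%E
    @[L --> \oo] --> ((expR (- 4 * k * t))%:E * bessel_sum)%E.
Proof.
move=> bessel_sum.
have [sum_lty sum_cvg] := truncated_bessel_sum_cvg sigma k sigma_gt0 k_gt0 _ _ PS Xi SIP_Xi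
  x good_x i t t_ge0.
split => //; under eq_cvg => L.
  rewrite (ABEP_current_moment sigma k sigma_gt0 k_gt0 _ _ PA X (truncate L x) i t ABEP_X)//; last first.
    by apply: truncate_finite_energy; case: good_x.
  over.
exact: cvgeZl.
Qed.
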